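(* Let $k\ge0$ be an integer and, for each $r$ with $1\le r\le k+1$, let $p_r\ge5$ be prime. Let $j$ be an integer with $j\not\equiv0\pmod{p_{k+1}}$, and suppose that either $p_{k+1}\not\equiv7,13\pmod{24}$, or $p_{k+1}\equiv7,13\pmod{24}$ and $\left(\frac{3j}{p_{k+1}}\right)=-1$. Then for every integer $n\ge0$: (1) If $j$ is odd, then $$\mathrm{ou}^*\left(4p_1^2\cdots p_{k+1}^2\,n+2p_1^2\cdots p_k^2\,p_{k+1}\,j+\tfrac{8p_1^2\cdots p_{k+1}^2+1}{3}\right)\equiv0\pmod4.$$ (2) If $j$ is even, then $$\mathrm{ou}^*\left(4p_1^2\cdots p_{k+1}^2\,n+2p_1^2\cdots p_k^2\,p_{k+1}\,j+\tfrac{2p_1^2\cdots p_{k+1}^2+1}{3}\right)\equiv0\pmod4.$$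
   Context: An odd strongly unimodal sequence of weight $n$ is a sequence of odd positive integers of the form $a_1<\cdots<a_r<c>b_1>\cdots>b_s$ (with $r,s\ge 0$) such that $n=c+\sum_{j=1}^r a_j+\sum_{j=1}^s b_j$. $\mathrm{ou}^*(n)$ denotes the number of odd strongly unimodal sequences of weight $n$ (so $\mathrm{ou}^*(n)=0$ for $n\le0$). $\left(\frac{\cdot}{p}\right)$ is the Legendre symbol. For $k=0$ the empty product $p_1^2\cdots p_k^2$ equals $1$. The primes $p_1,\dots,p_{k+1}$ are not required to be distinct. *)

(* Defs.v *)
From mathcomp Require Import all_boot all_order all_algebra.
Set Implicit Arguments.
Unset Strict Implicit.
Unset Printing Implicit Defensive.
Import GRing.Theory Num.Theory.
Local Open Scope ring_scope.

(* a_1 < ... < a_r < c > b_1 > ... > b_s with all entries odd: i = r is the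
   position of the peak c, and i : 'I_(size s) forces s to be nonempty. *)
Definition odd_strongly_unimodal (s : seq nat) : bool :=
  all odd s &&
  [exists i : 'I_(size s), sorted ltn (take i.+1 s) && sorted gtn (drop i s)].

(* The entries are positive, so a sequence of weight m has at most m entries,
   all of them at most m; this confines the count to a finite type.  It is 0
   for m <= 0. *)
Definition ou_star (m : int) : nat :=
  #|[set s : {bseq `|m|%N of 'I_(`|m|%N.+1)} |
      odd_strongly_unimodal (map val s) && ((sumn (map val s))%:Z == m)]|.

Definition legendre (a : int) (p : nat) : int :=
  if (p %| a)%Z then 0
  else if [exists x : 'I_p, (x%:Z ^+ 2 == a %[mod p])%Z] then 1 else -1.

(* The finite type in [ou_star] misses no sequence. *)
Lemma ou_starP (m : int) :
  exists l : seq (seq nat),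
    [/\ uniq l,
        forall s, (s \in l) = odd_strongly_unimodal s && ((sumn s)%:Z == m)
      & size l = ou_star m].
Proof.
pose f (s : {bseq `|m|%N of 'I_(`|m|%N.+1)}) := map val s.
have f_inj : injective f.
  by move=> s t; rewrite /f => /(inj_map val_inj) /val_inj.
set A := [set s : {bseq `|m|%N of 'I_(`|m|%N.+1)} |
  odd_strongly_unimodal (map val s) && ((sumn (map val s))%:Z == m)].
exists (map f (enum A)); split; last by rewrite size_map -cardE.
  by rewrite (map_inj_uniq f_inj) enum_uniq.
move=> s; apply/mapP/idP => [[t] | /andP[us /eqP ws]].
  by rewrite mem_enum inE => ? ->.
have le_sum (t : seq nat) : all odd t ->
    (size t <= sumn t)%N /\ all (fun x => x < (sumn t).+1)%N t.
  elim: t => //= x t IHt /andP[ox /IHt[st bt]]; have x0 := odd_gt0 ox; split.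
    by rewrite -add1n leq_add.
  rewrite ltnS leq_addr; apply: sub_all bt => y; rewrite !ltnS => /leq_trans.
  by apply; rewrite leq_addl.
have [/= ss bs] := le_sum s (proj1 (andP us)).
have mE : `|m|%N = sumn s by rewrite -ws.
rewrite -mE in ss bs.
pose g : seq 'I_(`|m|%N.+1) := map inord s.
have gE : map val g = s.
  rewrite -map_comp map_id_in // => x /(allP bs) ltx /=.
  exact: inordK.
have sg : (size g <= `|m|)%N by rewrite size_map.
exists (Bseq sg); last by rewrite /f gE.
by rewrite mem_enum inE /= gE us ws eqxx.
Qed.

(* Main.v *)
Require Import Defs.
From mathcomp Require Import all_boot all_order all_algebra.
From mathcomp Require Import finfield ring zify.
Set Implicit Arguments.
Unset Strict Implicit.
Unset Printing Implicit Defensive.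
Import Order.TTheory GRing.Theory Num.Theory.
Local Open Scope ring_scope.

(* Put N = 4 m + 1 and M = 6 m + 1 = (3 N - 1) / 2.  In the generating function
   of ou^* the square of a product of factors 1 + X^(2i+1) may be replaced, for
   odd weights and modulo 4, by the product of the factors 1 + X^(4i+2); hence
   ou^*(N) is modulo 4 the coefficient of X^(2m) in the third order mock theta
   function nu(-X).  By a bilateral (1psi1) summation the even part of nu is
   P(q) D(q)^3 with q = X^2, P(q) = (q; q)_oo, D(q) = (-q; q)_oo.  Since
   P(q)^2 D(q)^3 = P(q^4) P(-q), the pentagonal number theorem and Gauss's
   psi(q) = P(q) D(q)^2 turn it modulo 4 into P(q^4) - 2 G(q) psi(q), where G
   collects the odd pentagonal numbers.  The first term only matters when M is a
   square; the second counts representations of 4 M by v^2 + 3 u^2 with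
   v = +-3 modulo 8, which Eisenstein integers relate to those of M by
   x^2 + 3 y^2.  If p divides M to an odd power e and M = p^e M', their number
   is e + 1 times the one for M' (or 0, for p inert), so that the coefficient
   is even unless M' is a square and M = 7, 13 modulo 24; but then
   p = 7, 13 modulo 24 and 3 j is a square modulo p. *)

(** * Theta series in a ring with a nilpotent parameter *)

Section Nilpotent.
Context (T : comNzRingType) (N : nat) (N_gt0 : (0 < N)%N).
Implicit Types (u v w x y z Q : T) (n i j k J K L : nat).

(** This is (-u; Q)_n. For nilpotent [Q] the case n = [N] is already the infinite product. *)
Definition poch u Q n : T := \prod_(i < n) (1 + u * Q ^+ i).

Definition inv1p y : T := \sum_(i < N) (- y) ^+ i.

Definition ipoch v Q n : T := \prod_(i < n) inv1p (v * Q ^+ i).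

Definition pochser u Q y : T := \sum_(k < N) y ^+ k * poch u Q k.

(* The terms a^n Q^(n(n-1)/2), with Q = a w, of a bilateral theta series, for
   n = i - L; they are polynomials in w and Q when n < 0. *)
Definition theta_term a w L i : T :=
  if (i < L)%N then w ^+ (L - i) * (a * w) ^+ 'C(L - i, 2)
  else a ^+ (i - L) * (a * w) ^+ 'C(i - L, 2).

Lemma nilp_mull x y : x ^+ N = 0 -> (x * y) ^+ N = 0.
Proof. by move=> h; rewrite exprMn h mul0r. Qed.

Lemma nilp_mulr x y : y ^+ N = 0 -> (x * y) ^+ N = 0.
Proof. by move=> h; rewrite exprMn h mulr0. Qed.

Lemma nilp_exp0 x n : x ^+ N = 0 -> (N <= n)%N -> x ^+ n = 0.
Proof. by move=> h le_Nn; rewrite -(subnKC le_Nn) exprD h mul0r. Qed.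

Lemma nilp_exp x n : x ^+ N = 0 -> (0 < n)%N -> (x ^+ n) ^+ N = 0.
Proof. by move=> h n0; rewrite -exprM; apply: nilp_exp0 => //; rewrite leq_pmull. Qed.

Lemma nilp_opp x : x ^+ N = 0 -> (- x) ^+ N = 0.
Proof. by move=> h; rewrite exprNn h mulr0. Qed.

Lemma inv1pP y : y ^+ N = 0 -> (1 + y) * inv1p y = 1.
Proof.
move=> h; have := subrX1 (- y) N.
rewrite (nilp_opp h) sub0r -/(inv1p y) => /(congr1 -%R); rewrite opprK => E.
by rewrite [RHS]E; ring.
Qed.

Lemma inv1p0 : inv1p 0 = 1.
Proof. by have := @inv1pP 0; rewrite expr0n eqn0Ngt N_gt0 addr0 mul1r; apply. Qed.

Lemma poch0 u Q : poch u Q 0 = 1.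
Proof. exact: big_ord0. Qed.

Lemma ipoch0 v Q : ipoch v Q 0 = 1.
Proof. exact: big_ord0. Qed.

Lemma pochS u Q n : poch u Q n.+1 = poch u Q n * (1 + u * Q ^+ n).
Proof. exact: big_ord_recr. Qed.

Lemma ipochS v Q n : v ^+ N = 0 ->
  ipoch v Q n.+1 * (1 + v * Q ^+ n) = ipoch v Q n.
Proof.
move=> h; rewrite /ipoch big_ord_recr /= -mulrA [inv1p _ * _]mulrC.
by rewrite inv1pP ?mulr1 // nilp_mull.
Qed.

Lemma poch_ipoch v Q n : v ^+ N = 0 -> poch v Q n * ipoch v Q n = 1.
Proof.
move=> h; rewrite -big_split big1 //= => i _.
by rewrite inv1pP // nilp_mull.
Qed.

Lemma poch_stable u Q n : Q ^+ N = 0 -> (N <= n)%N -> poch u Q n = poch u Q N.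
Proof.
move=> h /subnKC <-; elim: (n - N)%N => [|m IHm]; first by rewrite addn0.
by rewrite addnS pochS IHm (nilp_exp0 h) ?leq_addr // mulr0 addr0 mulr1.
Qed.

Lemma ipoch_stable v Q n : Q ^+ N = 0 -> (N <= n)%N ->
  ipoch v Q n = ipoch v Q N.
Proof.
move=> h /subnKC <-; elim: (n - N)%N => [|m IHm]; first by rewrite addn0.
rewrite addnS {1}/ipoch big_ord_recr /= -/(ipoch v Q _) IHm.
by rewrite (nilp_exp0 h) ?leq_addr // mulr0 inv1p0 mulr1.
Qed.

Lemma poch_telescope u Q n :
  u * (\sum_(k < n) Q ^+ k * poch u Q k) = poch u Q n - 1.
Proof.
elim: n => [|n IHn]; first by rewrite big_ord0 poch0; ring.
by rewrite big_ord_recr /= mulrDr IHn pochS; ring.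
Qed.

(** Multiply (-u; Q)_(k+1) = (-u; Q)_k (1 + u Q^k) by y^(k+1) and sum over k; the truncation error
    carries y^N = 0. *)
Lemma pochser_rec u Q y : y ^+ N = 0 ->
  (1 - y) * pochser u Q y = 1 + u * y * pochser u Q (Q * y).
Proof.
move=> h; suff H n : (1 - y) * (\sum_(k < n) y ^+ k * poch u Q k) =
    1 + u * y * (\sum_(k < n) (Q * y) ^+ k * poch u Q k) - y ^+ n * poch u Q n.
  by rewrite H h mul0r subr0.
elim: n => [|n IHn]; first by rewrite !big_ord0 poch0; ring.
by rewrite !big_ord_recr /= !mulrDr IHn pochS exprMn exprS; ring.
Qed.

(* One factor of (z; Q)_oo multiplies the bilateral series
   sum_n (-u; Q)_n z^n; each such step moves the switch between the two forms
   of the summand one place to the right. *)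
Lemma bilateral_step u v Q y (c : nat -> T) J :
  v ^+ N = 0 -> y ^+ N = 0 -> c 0%N = 0 ->
  (forall i, (i < J)%N -> c i.+1 * (v * Q ^+ (J - i.+1)) = y * c i) ->
  c J.+1 = c J * (u * y) ->
  (1 - y) * (\sum_(i < J) c i * ipoch v Q (J - i) + c J * pochser u Q y) =
  \sum_(i < J.+1) c i * ipoch v Q (J.+1 - i) + c J.+1 * pochser u Q (Q * y).
Proof.
move=> hv hy c0 hc hJ.
rewrite mulrDr mulrCA pochser_rec // hJ.
have -> : (1 - y) * (\sum_(i < J) c i * ipoch v Q (J - i)) =
  \sum_(i < J) c i * ipoch v Q (J - i) - (\sum_(i < J) c i.+1 *
    ipoch v Q (J - i.+1) - \sum_(i < J) c i.+1 * ipoch v Q (J.+1 - i.+1)).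
  rewrite mulrBl mul1r mulr_sumr -[in RHS]sumrB; congr (_ - _).
  apply: eq_bigr => i _; rewrite mulrA -hc // subSS.
  rewrite -(subnSK (ltn_ord i)) -(ipochS Q (J - i.+1) hv); ring.
have -> : \sum_(i < J) c i * ipoch v Q (J - i) =
  \sum_(i < J.+1) c i * ipoch v Q (J - i) - c J.
  by rewrite big_ord_recr /= subnn ipoch0 mulr1 addrK.
rewrite 2!big_ord_recl c0 !mul0r !add0r; under eq_bigr do rewrite lift0.
under [in RHS]eq_bigr do rewrite lift0.
ring.
Qed.

Lemma theta_term_ge a w L i : (L <= i)%N ->
  theta_term a w L i.+1 = theta_term a w L i * (a * (a * w) ^+ (i - L)).
Proof.
move=> le; rewrite /theta_term !ltnNge le leqW //= subSn // binS bin1 exprS exprD.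
by ring.
Qed.

(** The ratio a Q^n of consecutive terms, inverted for n < 0 by means of 1/a = w/Q. *)
Lemma theta_term_lt a w L i : (i < L)%N ->
  theta_term a w L i = theta_term a w L i.+1 * (w * (a * w) ^+ (L - i.+1)).
Proof.
move=> lt; rewrite /theta_term lt; have -> : (L - i = (L - i.+1).+1)%N by lia.
case: ltnP => h; rewrite binS bin1 exprD exprS; first by ring.
have -> : (L - i.+1 = 0)%N by lia.
have -> : (i.+1 - L = 0)%N by lia.
by rewrite bin0n !expr0; ring.
Qed.

(** Here 'C(n, 2) >= N for n > N. The indices below 2 L thus carry the whole bilateral series, and
    it can be shifted by one. *)
Lemma theta_term0 a w L i : (a * w) ^+ N = 0 -> (N < L)%N ->
  (i == 0%N) || (2 * L <= i)%N -> theta_term a w L i = 0.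
Proof.
have H n : (N < n)%N -> (N <= 'C(n, 2))%N.
  by move=> lt; rewrite bin2 -divn2 leq_divRL //; nia.
move=> h lt; rewrite /theta_term; case: ltnP => hi hl.
  by rewrite (nilp_exp0 h) ?mulr0 //; apply: H; lia.
by rewrite (nilp_exp0 h) ?mulr0 //; apply: H; lia.
Qed.

(** Formally [v] is Q/u. The start [K0] serves the Jacobi triple product, where z = 1 is not
    nilpotent and the factor 1 - z is zero: it begins at [K0] = 1. The series nu has z = x and
    begins at 0. *)
Lemma bilateral_iter u z w L K0 K : let Q := z * u * w in let v := z * w in
  let c := theta_term (z * u) w L in
  Q ^+ N = 0 -> v ^+ N = 0 -> (Q ^+ K0 * z) ^+ N = 0 -> (N < L)%N ->
  (\prod_(K0 <= j < K0 + K) (1 - Q ^+ j * z)) *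
    (\sum_(i < K0 + L) c i * ipoch v Q (K0 + L - i) +
     c (K0 + L)%N * pochser u Q (Q ^+ K0 * z)) =
  \sum_(i < K0 + K + L) c i * ipoch v Q (K0 + K + L - i) +
     c (K0 + K + L)%N * pochser u Q (Q ^+ (K0 + K) * z).
Proof.
move=> Q v c hQ hv hz lt_L; elim: K => [|K IHK].
  by rewrite !addn0 big_geq // mul1r.
rewrite addnS big_nat_recr ?leq_addr //= mulrAC IHK mulrC {IHK}.
rewrite bilateral_step //.
- by rewrite addSn exprS mulrA.
- by rewrite exprD mulrAC nilp_mull.
- by rewrite /c theta_term0.
- move=> i lt_i; case: (ltnP i L) => [lt_iL|ge_iL].
    rewrite [in RHS]/c theta_term_lt // -/c -/Q.
    have -> : (K0 + K + L - i.+1 = (K0 + K) + (L - i.+1))%N by lia.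
    by rewrite exprD /v; ring.
  rewrite /c theta_term_ge // -/c -/Q.
  have {2}-> : (K0 + K = (i - L) + (K0 + K + L - i.+1).+1)%N by lia.
  by rewrite exprD exprS /v /Q; ring.
by rewrite /c theta_term_ge ?leq_addl // addnK -/Q; ring.
Qed.

(** The terms with i >= 2 L vanish, and for the others K + L - i exceeds [N], so that their products
    have all reached the stable value. *)
Lemma bilateral_lim u z w L K : let Q := z * u * w in let v := z * w in
  let c := theta_term (z * u) w L in
  Q ^+ N = 0 -> (N < L)%N -> (L + N < K)%N ->
  \sum_(i < K + L) c i * ipoch v Q (K + L - i) +
     c (K + L)%N * pochser u Q (Q ^+ K * z) =
  (\sum_(i < 2 * L) c i) * ipoch v Q N.
Proof.
move=> Q v c hQ ltL ltK.
have c0 i : (2 * L <= i)%N -> c i = 0.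
  by move=> hi; rewrite /c theta_term0 ?hi ?orbT.
rewrite c0 ?mul0r ?addr0; last by lia.
rewrite -(subnKC (_ : 2 * L <= K + L)%N); last by lia.
rewrite big_split_ord /= [X in _ + X]big1 ?addr0 => [|i _]; last first.
  by rewrite c0 ?mul0r ?leq_addr.
rewrite mulr_suml; apply: eq_bigr => i _; congr (_ * _).
by apply: ipoch_stable => //; have := ltn_ord i; lia.
Qed.

(** The bilateral summation at z = 1: its initial value is (-u; Q)_oo, its limit the theta series
    divided by (-v; Q)_oo. *)
Lemma jacobi_triple u v L : v ^+ N = 0 -> (N < L)%N ->
  \sum_(i < 2 * L) theta_term u v L i =
  poch (- (u * v)) (u * v) N * poch u (u * v) N * poch v (u * v) N.
Proof.
move=> hv ltL; have hQ : (u * v) ^+ N = 0 by rewrite nilp_mulr.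
have := @bilateral_iter u 1 v L 1 (L + N)%N.
have := @bilateral_lim u 1 v L (1 + (L + N))%N.
rewrite /= !mul1r !mulr1 => -> // /(_ hQ hv).
rewrite expr1 => /(_ hQ ltL).
have -> : \prod_(1 <= j < 1 + (L + N)) (1 - (u * v) ^+ j * 1) =
    poch (- (u * v)) (u * v) N.
  rewrite -(poch_stable _ (n := L + N)) ?leq_addl // big_add1 /= big_mkord.
  by apply: eq_bigr => i _; rewrite mulr1 exprS mulNr.
(* The partial sum up to index m collapses to one term, which is 1 at m = L. *)
have -> : \sum_(i < 1 + L) theta_term u v L i * ipoch v (u * v) (1 + L - i) = 1.
  have H m : (m <= L)%N -> \sum_(i < m.+1) theta_term u v L i *
      ipoch v (u * v) (1 + L - i) = theta_term u v L m * ipoch v (u * v) (L - m).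
    elim: m => [|m IHm] ltm.
      by rewrite big_ord_recl big_ord0 theta_term0 ?mul0r ?addr0.
    rewrite big_ord_recr IHm 1?ltnW //= theta_term_lt //.
    have -> : (L - m = (L - m.+1).+1)%N by lia.
    have -> : (1 + L - m.+1 = (L - m.+1).+1)%N by lia.
    by rewrite -(ipochS _ (L - m.+1) hv); ring.
  rewrite H // subnn /theta_term ltnn subnn bin0n ipoch0 !expr0; ring.
have -> : theta_term u v L (1 + L) * pochser u (u * v) (u * v) =
    poch u (u * v) N - 1.
  have -> : theta_term u v L (1 + L) = u.
    by rewrite theta_term_ge // /theta_term ltnn subnn !expr0; ring.
  exact: poch_telescope.
rewrite addrC subrK => H; rewrite H -mulrA [ipoch _ _ _ * _]mulrC.
by rewrite poch_ipoch // mulr1.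
Qed.

(** [euler] and [deuler] are P and D. [pent] is the theta series of the pentagonal numbers, with Q =
    y^3, and [psi] is Gauss's series over the triangular numbers. *)
Definition euler y := poch (- y) y N.
Definition deuler y := poch y y N.
Definition pent L y := \sum_(i < 2 * L) theta_term (- y) (- (y ^+ 2)) L i.
Definition psi L y := \sum_(j < L) y ^+ 'C(j.+1, 2).

Lemma poch_split2 u Q n :
  poch u Q (2 * n) = poch u (Q ^+ 2) n * poch (u * Q) (Q ^+ 2) n.
Proof.
elim: n => [|n IHn]; first by rewrite !poch0 mulr1.
by rewrite mulnS !pochS IHn -!exprM [Q ^+ (2 * n).+1]exprS; ring.
Qed.

Lemma poch_split3 u Q n : poch u Q (3 * n) =
  poch u (Q ^+ 3) n * poch (u * Q) (Q ^+ 3) n * poch (u * Q ^+ 2) (Q ^+ 3) n.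
Proof.
elim: n => [|n IHn]; first by rewrite !poch0 !mulr1.
by rewrite mulnS !pochS IHn -!exprM [Q ^+ (3 * n).+2]exprS [Q ^+ (3 * n).+1]exprS; ring.
Qed.

Lemma poch_even_odd u Q : Q ^+ N = 0 ->
  poch u Q N = poch u (Q ^+ 2) N * poch (u * Q) (Q ^+ 2) N.
Proof. by move=> h; rewrite -poch_split2 poch_stable // leq_pmull. Qed.

Lemma euler_sqr y : y ^+ N = 0 -> euler (y ^+ 2) = euler y * deuler y.
Proof.
move=> h; rewrite /euler /deuler /poch -big_split; apply: eq_bigr => i _ /=.
by rewrite -exprM mulnC exprM; ring.
Qed.

Lemma euler_regular y a b : y ^+ N = 0 -> a * euler y = b * euler y -> a = b.
Proof.
move=> h /(congr1 ( *%R^~ (ipoch (- y) y N))).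
by rewrite /= -!mulrA poch_ipoch ?mulr1 //; apply: nilp_opp.
Qed.

(** Euler's theorem on partitions into odd and into distinct parts: P(y) = (y; y^2)_oo P(y^2) and
    P(y^2) = P(y) D(y), where P(y) is a unit. *)
Lemma euler_odd_distinct y : y ^+ N = 0 -> poch (- y) (y ^+ 2) N * deuler y = 1.
Proof.
move=> h; apply: (euler_regular h); rewrite mul1r [in RHS]/euler (poch_even_odd _ h).
by rewrite mulNr -expr2 -/(euler (y ^+ 2)) euler_sqr //; ring.
Qed.

(** Pentagonal number theorem: the three products of the Jacobi identity are the residue classes
    modulo 3 of the factors of P(y). *)
Lemma euler_pent L y : y ^+ N = 0 -> (N < L)%N -> pent L y = euler y.
Proof.
move=> h ltL; rewrite /pent jacobi_triple //; last first.
  by apply: nilp_opp; apply: nilp_exp.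
have -> : - y * - (y ^+ 2) = y ^+ 3 by ring.
rewrite /euler -(@poch_stable _ y (3 * N)) ?leq_pmull // poch_split3.
by rewrite !mulNr -expr2 -exprS; ring.
Qed.

Lemma poch1 y : y ^+ N = 0 -> poch 1 y N = 2 * deuler y.
Proof.
move=> h; rewrite -(poch_stable _ h (leqnSn N)) /poch big_ord_recl expr0 mulr1.
by congr (_ * _); apply: eq_bigr => i _; rewrite lift0 exprS mul1r.
Qed.

(** The indices n and -1 - n give the same triangular number. *)
Lemma two_psi_theta L y : y ^+ N = 0 -> (N < L)%N ->
  \sum_(i < 2 * L) theta_term y 1 L i = 2 * psi L y.
Proof.
move=> h ltL; rewrite mul2n -addnn big_split_ord /= mulr_natl mulr2n.
congr (_ + _).
  rewrite (reindex_inj rev_ord_inj); apply: eq_bigr => i _ /=.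
  rewrite /theta_term; have lti := ltn_ord i.
  have -> : (L - i.+1 < L)%N by lia.
  have -> : (L - (L - i.+1) = i.+1)%N by lia.
  by rewrite mulr1 expr1n mul1r.
apply: eq_bigr => i _; rewrite /theta_term ltnNge leq_addr /= addKn mulr1.
by rewrite -exprD binS bin1 addnC.
Qed.

(** An index shift by one makes [jacobi_triple] applicable, whose second parameter must be nilpotent
    and so cannot be 1. *)
Lemma theta_shift L y : y ^+ N = 0 -> (N < L)%N ->
  \sum_(i < 2 * L) theta_term y 1 L i = \sum_(i < 2 * L) theta_term 1 y L i.
Proof.
move=> h ltL; transitivity (\sum_(i < (2 * L).+1) theta_term 1 y L i).
  rewrite big_ord_recl [X in X + _]theta_term0 ?mul1r // add0r.
  apply: eq_bigr => i _; rewrite lift0 /theta_term !mulr1 !mul1r.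
  case: (ltngtP i.+1 L) => [lti|lti|eqi].
  - rewrite expr1n mul1r -exprD.
    have -> : (L - i = (L - i.+1).+1)%N by lia.
    by rewrite binS bin1 addnC.
  - rewrite expr1n mul1r -exprD subSn //.
    by rewrite binS bin1 addnC.
  have -> : (L - i = 1)%N by lia.
  have -> : (i.+1 - L = 0)%N by lia.
  by rewrite bin0n !expr1n.
by rewrite big_ord_recr /= [X in _ + X]theta_term0 ?mul1r ?leqnn ?orbT // addr0.
Qed.

(* Doubled because 2 cannot be cancelled in T. *)
Lemma two_psi L y : y ^+ N = 0 -> (N < L)%N ->
  2 * psi L y = 2 * (euler y * deuler y ^+ 2).
Proof.
move=> h ltL; rewrite -two_psi_theta // theta_shift // jacobi_triple // mul1r.
rewrite poch1 // -/(euler y) -/(deuler y); ring.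
Qed.

(** The terms with n < 0 form the series of x^(j(j+1)) / (-x; x^2)_(j+1), the usual definition of
    nu(x). Iterating [pochser_rec] turns it into the series of (-x)^k (x; x^2)_k. *)
Lemma theta_neg x L : x ^+ N = 0 -> (N < L)%N ->
  \sum_(i < L) theta_term (x * x) 1 L i * ipoch x (x ^+ 2) (L - i) =
  pochser (- x) (x ^+ 2) (- x).
Proof.
move=> h ltL; have hQ : (x ^+ 2) ^+ N = 0 by exact: nilp_exp.
have H n : pochser (- x) (x ^+ 2) (- x) =
    \sum_(j < n) (x ^+ 2) ^+ 'C(j.+1, 2) * ipoch x (x ^+ 2) j.+1 +
    (x ^+ 2) ^+ 'C(n.+1, 2) * ipoch x (x ^+ 2) n *
      pochser (- x) (x ^+ 2) ((x ^+ 2) ^+ n * - x).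
  elim: n => [|n ->].
    by rewrite big_ord0 ipoch0 bin_small // !expr0 !mul1r add0r.
  rewrite big_ord_recr /= -addrA; congr (_ + _).
  have hy : ((x ^+ 2) ^+ n * - x) ^+ N = 0 by apply/nilp_mulr/nilp_opp.
  have := pochser_rec (- x) (x ^+ 2) hy.
  have -> : 'C(n.+2, 2) = ('C(n.+1, 2) + n.+1)%N by rewrite binS bin1.
  rewrite -(ipochS (x ^+ 2) n h) [x ^+ 2 * (_ * _)]mulrA -exprS => E.
  transitivity ((x ^+ 2) ^+ 'C(n.+1, 2) * ipoch x (x ^+ 2) n.+1 *
    ((1 - (x ^+ 2) ^+ n * - x) *
      pochser (- x) (x ^+ 2) ((x ^+ 2) ^+ n * - x))); first by ring.
  by rewrite E exprD [(x ^+ 2) ^+ n.+1]exprS; ring.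
rewrite (H L) (nilp_exp0 hQ (n := 'C(L.+1, 2))) ?mul0r ?addr0; last first.
  by rewrite binS bin1; lia.
rewrite (reindex_inj rev_ord_inj); apply: eq_bigr => i _ /=.
rewrite /theta_term; have lti := ltn_ord i.
have -> : (L - i.+1 < L)%N by lia.
have -> : (L - (L - i.+1) = i.+1)%N by lia.
by rewrite mulr1 expr1n mul1r expr2.
Qed.

(** For u = z = x the bilateral series is nu(-x) + nu(x), and its theta series is 2 psi(x^2). *)
Lemma nu_even_part x L : x ^+ N = 0 -> (N < L)%N ->
  pochser x (x ^+ 2) x + pochser (- x) (x ^+ 2) (- x) =
  2 * (euler (x ^+ 2) * deuler (x ^+ 2) ^+ 3).
Proof.
move=> h ltL; have hQ : (x ^+ 2) ^+ N = 0 by exact: nilp_exp.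
have := @bilateral_lim x x 1 L (L + N).+1.
have := @bilateral_iter x x 1 L 0 (L + N).+1.
rewrite /= !mulr1 !add0n expr0 mul1r -expr2 => H1 H2.
have {H1 H2} := etrans (H1 hQ h h ltL) (H2 hQ ltL (leqnn _)).
rewrite two_psi_theta // two_psi //.
have -> : theta_term (x ^+ 2) 1 L L = 1.
  by rewrite /theta_term ltnn subnn bin0n !expr0 mulr1.
have -> : \prod_(0 <= j < (L + N).+1) (1 - (x ^+ 2) ^+ j * x) =
    poch (- x) (x ^+ 2) N.
  rewrite -(poch_stable (- x) hQ (leqW (leq_addl L N))) big_mkord.
  by apply: eq_bigr => i _; rewrite mulNr mulrC.
have := theta_neg h ltL; rewrite -expr2 => -> E.
set S := _ + _.
have {}E : poch (- x) (x ^+ 2) N * poch x (x ^+ 2) N * S =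
    2 * (euler (x ^+ 2) * deuler (x ^+ 2) ^+ 2).
  rewrite mulrAC; have -> : S = pochser (- x) (x ^+ 2) (- x) + 1 * pochser x (x ^+ 2) x.
    by rewrite mul1r addrC.
  by rewrite E -[RHS]mulr1 -(poch_ipoch (x ^+ 2) N h); ring.
(* This product is (q; q^2)_oo with q = x^2, the inverse of D(q) by Euler's theorem. *)
have E' : poch (- x) (x ^+ 2) N * poch x (x ^+ 2) N =
    poch (- (x ^+ 2)) ((x ^+ 2) ^+ 2) N.
  rewrite -big_split; apply: eq_bigr => i _ /=.
  by rewrite (exprAC (x ^+ 2) 2 i); ring.
have -> : S = poch (- (x ^+ 2)) ((x ^+ 2) ^+ 2) N * deuler (x ^+ 2) * S.
  by rewrite euler_odd_distinct // mul1r.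
rewrite -E' mulrAC E; ring.
Qed.

(** The left side is P(y^2)^2 D(y). Splitting D(y) by the parity of the exponents, D(y^2) completes
    one P(y^2) to P(y^4) and (-y; y^2)_oo the other to P(-y). *)
Lemma euler_neg y : y ^+ N = 0 ->
  euler y * deuler y ^+ 3 * euler y = euler (y ^+ 4) * euler (- y).
Proof.
move=> h; have h2 : (y ^+ 2) ^+ N = 0 by exact: nilp_exp.
have -> : y ^+ 4 = (y ^+ 2) ^+ 2 by rewrite -exprM.
have -> : euler (- y) = poch y (y ^+ 2) N * euler (y ^+ 2).
  rewrite {1}/euler opprK poch_even_odd; last exact: nilp_opp.
  by rewrite sqrrN mulrN -expr2.
have -> : deuler y = poch y (y ^+ 2) N * deuler (y ^+ 2).
  by rewrite {1}/deuler poch_even_odd // -expr2.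
rewrite (euler_sqr h2) (euler_sqr h).
have -> : deuler y = poch y (y ^+ 2) N * deuler (y ^+ 2).
  by rewrite {1}/deuler poch_even_odd // -expr2.
ring.
Qed.

(** Each factor satisfies (1 - t)^2 = 1 - t^2 modulo 2, hence modulo 4 after doubling. *)
Lemma double_euler_sqr y : (4 : T) = 0 -> y ^+ N = 0 ->
  2 * euler y ^+ 2 = 2 * euler (y ^+ 2).
Proof.
move=> T4 h; rewrite /euler /poch; elim: {h}N => [|n IHn].
  by rewrite !big_ord0 expr1n.
rewrite !big_ord_recr /= [(y ^+ 2) ^+ n]exprAC exprMn [LHS]mulrA IHn.
set p := \prod_(i < n) _; set t := y ^+ n.
have -> : 2 * p * (1 + - y * t) ^+ 2 =
  2 * (p * (1 + - y ^+ 2 * t ^+ 2)) + 4 * (p * (y * t) * (y * t - 1)) by ring.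
by rewrite T4 mul0r addr0.
Qed.

(* P(-y) = P(y) - 2 g in P(y)^2 D(y)^3 = P(y^4) P(-y), while 2 psi(y) P(y) =
   2 P(y)^2 D(y)^2 = 2 P(y^2)^2 is 2 P(y^4) modulo 4. *)
Lemma euler_mod4 L y g : (4 : T) = 0 -> y ^+ N = 0 -> (N < L)%N ->
  pent L y - pent L (- y) = 2 * g ->
  euler y * deuler y ^+ 3 = pent L (y ^+ 4) - 2 * (g * psi L y).
Proof.
move=> T4 h ltL; rewrite !euler_pent //; last 2 first.
- exact: nilp_exp.
- exact: nilp_opp.
move=> hg; have h2 : (y ^+ 2) ^+ N = 0 by exact: nilp_exp.
apply: (euler_regular h); rewrite euler_neg //.
have -> : euler (- y) = euler y - 2 * g by rewrite -hg; ring.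
have : 2 * psi L y * euler y = 2 * euler (y ^+ 4).
  have -> : y ^+ 4 = (y ^+ 2) ^+ 2 by rewrite -exprM.
  rewrite two_psi // -double_euler_sqr // euler_sqr //; ring.
move=> E.
transitivity (euler y * euler (y ^+ 4) - g * (2 * euler (y ^+ 4))); first by ring.
rewrite -E; ring.
Qed.

End Nilpotent.

(** * The even part of nu modulo 4 *)

Section Morphism.
Context (T T' : comNzRingType) (f : {rmorphism T -> T'}).

Lemma rmorph_poch u Q n : f (poch u Q n) = poch (f u) (f Q) n.
Proof.
rewrite rmorph_prod; apply: eq_bigr => i _.
by rewrite rmorphD rmorphM rmorphXn rmorph1.
Qed.

Lemma rmorph_pochser N u Q y : f (pochser N u Q y) = pochser N (f u) (f Q) (f y).
Proof.
rewrite rmorph_sum; apply: eq_bigr => i _.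
by rewrite rmorphM rmorphXn rmorph_poch.
Qed.

Lemma rmorph_euler N y : f (euler N y) = euler N (f y).
Proof. by rewrite rmorph_poch rmorphN. Qed.

Lemma rmorph_deuler N y : f (deuler N y) = deuler N (f y).
Proof. exact: rmorph_poch. Qed.

Lemma rmorph_pent L y : f (pent L y) = pent L (f y).
Proof.
rewrite rmorph_sum; apply: eq_bigr => i _; rewrite /theta_term.
by case: ifP; rewrite !(rmorphM, rmorphXn, rmorphN).
Qed.

Lemma rmorph_psi L y : f (psi L y) = psi L (f y).
Proof. by rewrite rmorph_sum; apply: eq_bigr => i _; rewrite rmorphXn. Qed.
End Morphism.

(** The nilpotent parameter will be the class of 'X modulo 'X^n; this returns to coefficients. *)
Lemma in_qpoly_coef (R : comNzRingType) n (p q : {poly R}) i :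
  in_qpoly 'X^n p = in_qpoly 'X^n q -> (i < n)%N -> p`_i = q`_i.
Proof.
move=> /(congr1 (@polyn _ _)) /= E lt_in.
have n0 : (0 < n)%N by apply: leq_trans lt_in.
have Xmon : 'X^n \is @monic R by exact: monicXn.
rewrite mk_monic_Xn prednK // in E.
have H (r : {poly R}) : r`_i = (Pdiv.CommonRing.rmodp r 'X^n)`_i.
  by rewrite {1}(Pdiv.RingMonic.rdivp_eq Xmon r) coefD coefMXn lt_in add0r.
by rewrite H E -H.
Qed.

Lemma in_qpolyXn (R : comNzRingType) n (p : {poly R}) : (0 < n)%N ->
  in_qpoly 'X^n ('X * p) ^+ n = 0.
Proof.
move=> n0; rewrite -rmorphXn exprMn; apply/val_inj => /=.
rewrite mk_monic_Xn prednK // mulrC.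
by rewrite Pdiv.RingMonic.rmodp_mull // monicXn.
Qed.

(* A truncation of nu(-X). *)
Definition nu_gf N : {poly int} := pochser N 'X ('X^2) 'X.

Definition nu_even N : {poly int} := euler N 'X * deuler N 'X ^+ 3.

Lemma coef_compN (R : comNzRingType) (p : {poly R}) i :
  (p \Po - 'X)`_i = (-1) ^+ i * p`_i.
Proof.
rewrite coef_comp_poly.
under eq_bigr do
  rewrite exprNn -(polyCN 1) -polyC_exp coefCM coefXn.
have [lt_ip|le_pi] := ltnP i (size p).
  rewrite (bigD1 (Ordinal lt_ip)) //= eqxx mulr1 mulrC big1 ?addr0 // => j.
  by rewrite -val_eqE /= eq_sym => /negPf->; rewrite !mulr0.
rewrite nth_default // mulr0 big1 // => j _.
by rewrite gtn_eqF ?mulr0 // (leq_trans (ltn_ord j)).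
Qed.

(** Stated over the integers, where the factor 2 of [nu_even_part] can be cancelled. *)
Lemma nu_even_coef N m : (2 * m < N)%N -> (nu_gf N)`_(2 * m) = (nu_even N)`_m.
Proof.
move=> ltN; have N0 : (0 < N)%N by lia.
have E : in_qpoly 'X^N (nu_gf N + (nu_gf N \Po - 'X)) =
         in_qpoly 'X^N (2 * (nu_even N \Po 'X^2)).
  have := @nu_even_part {poly %/ ('X^N : {poly int})} N N0 (in_qpoly 'X^N 'X) N.+1.
  have := in_qpolyXn (1 : {poly int}) N0; rewrite mulr1 => hX /(_ hX (ltnSn _)).
  have -> : nu_gf N \Po - 'X = pochser N (- 'X) ('X^2) (- 'X).
    rewrite [LHS](rmorph_pochser (comp_poly _)) /= comp_polyX.
    by rewrite rmorphXn /= comp_polyX sqrrN.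
  have -> : nu_even N \Po 'X^2 = euler N ('X^2) * deuler N ('X^2) ^+ 3.
    rewrite [LHS](rmorphM (comp_poly _)) rmorphXn /=.
    rewrite (rmorph_euler (comp_poly _)) (rmorph_deuler (comp_poly _)) /=.
    by rewrite comp_polyX.
  move=> E; rewrite rmorphD /nu_gf !rmorph_pochser rmorphN rmorphXn E.
  rewrite [in RHS]rmorphM rmorph_nat [in RHS]rmorphM rmorph_euler.
  by rewrite !rmorphXn rmorph_deuler rmorphXn.
have /(_ _ ltN) := in_qpoly_coef E.
rewrite coefD coef_compN exprM sqrrN expr1n mul1r mulr_natl.
rewrite -mulr2n !coefMn coef_comp_poly_Xn // dvdn_mulr // mulKn //.
exact: pmulrnI.
Qed.

(* k (3 k - 1) / 2 for k = i - L. *)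
Definition pent_exp L i : nat :=
  if (i < L)%N then (2 * (L - i) + 3 * 'C(L - i, 2))%N
  else ((i - L) + 3 * 'C(i - L, 2))%N.

Definition pent_sgn (T : comNzRingType) L i : T :=
  (-1) ^+ (if (i < L)%N then L - i else i - L)%N.

Lemma pent_term (T : comNzRingType) L i (y : T) :
  theta_term (- y) (- (y ^+ 2)) L i = pent_sgn T L i * y ^+ pent_exp L i.
Proof.
rewrite /theta_term /pent_sgn /pent_exp; have -> : - y * - (y ^+ 2) = y ^+ 3 by ring.
case: ifP => _; rewrite -exprM exprD [in LHS]exprNn; last by rewrite mulrA.
by rewrite -exprM mulrA.
Qed.

(** Signs disappear in 2 G psi modulo 4, so its coefficient is twice the number of ways to write m
    as an odd pentagonal plus a triangular number. The condition on 4 [pent_exp] removes P(q^4). *)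
Lemma nu_even_mod4 N m L : (m < N < L)%N ->
  (forall i, 4 * pent_exp L i != m)%N ->
  ~~ odd #|[set ij : 'I_(2 * L) * 'I_L | odd (pent_exp L ij.1) &&
      (pent_exp L ij.1 + 'C(ij.2.+1, 2) == m)%N]| ->
  ((nu_even N)`_m)%:~R = 0 :> 'Z_4.
Proof.
move=> /andP[lt_mN lt_NL] no_sqr even_c; have N0 : (0 < N)%N by lia.
pose R := {poly 'Z_4}; pose X : R := 'X.
pose g (T : comNzRingType) (y : T) := \sum_(i < 2 * L)
  (odd (pent_exp L i))%:R * pent_sgn T L i * y ^+ pent_exp L i.
(* The change of sign of y cancels the even exponents and doubles the odd ones. *)
have hg (T : comNzRingType) (y : T) : pent L y - pent L (- y) = 2 * g T y.
  rewrite /pent /g mulr_sumr -sumrB; apply: eq_bigr => i _.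
  rewrite !pent_term exprNn -signr_odd; case: odd; rewrite /= ?expr1 ?expr0; ring.
have E : in_qpoly 'X^N (euler N X * deuler N X ^+ 3) =
         in_qpoly 'X^N (pent L (X ^+ 4) - 2 * (g R X * psi L X)).
  have hX := in_qpolyXn (1 : R) N0; rewrite mulr1 in hX.
  have T4 : 4 = 0 :> {poly %/ ('X^N : R)}.
    by rewrite -(rmorph_nat (in_qpoly ('X^N : R))) -polyC_natr char_Zp // rmorph0.
  have := @euler_mod4 _ N N0 L _ _ T4 hX lt_NL (hg _ _).
  have -> : g _ (in_qpoly 'X^N 'X) = in_qpoly 'X^N (g R X).
    rewrite /g rmorph_sum; apply: eq_bigr => i _.
    by rewrite !rmorphM rmorph_nat !rmorphXn rmorphN rmorph1.
  move=> H; rewrite rmorphM rmorph_euler rmorphXn rmorph_deuler H.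
  by rewrite rmorphB rmorph_pent rmorphXn !rmorphM rmorph_nat rmorph_psi.
have /(_ _ lt_mN) := in_qpoly_coef E.
have -> : (euler N X * deuler N X ^+ 3)`_m = ((nu_even N)`_m)%:~R.
  rewrite -coef_map /nu_even rmorphM rmorphXn.
  by rewrite rmorph_euler rmorph_deuler /= map_polyX.
move=> ->; rewrite coefB.
have sgnE i : pent_sgn R L i = (pent_sgn 'Z_4 L i)%:P.
  by rewrite /pent_sgn polyC_exp polyCN.
have -> : (pent L (X ^+ 4))`_m = 0.
  rewrite coef_sum big1 // => i _; rewrite pent_term -exprM sgnE coefCM coefXn.
  by rewrite eq_sym (negPf (no_sqr i)) mulr0.
rewrite sub0r mulr_natl coefMn mulr_suml coef_sum.
set S := [set ij | _] in even_c.
suff -> : (\sum_(i < 2 * L) ((odd (pent_exp L i))%:R * pent_sgn R L i *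
   X ^+ pent_exp L i * psi L X)`_m) *+ 2 = (#|S|%:R : 'Z_4) *+ 2.
  rewrite -mulrnA -[#|S|]odd_double_half (negPf even_c) add0n.
  by rewrite -mul2n mulnAC natrM char_Zp // mul0r oppr0.
transitivity ((\sum_(ij : 'I_(2 * L) * 'I_L) ((odd (pent_exp L ij.1))%:R *
  pent_sgn R L ij.1 * X ^+ pent_exp L ij.1 * X ^+ 'C(ij.2.+1, 2))`_m) *+ 2).
  congr (_ *+ 2); rewrite -(pair_bigA _ (fun (i : 'I_(2 * L)) (j : 'I_L) => ((odd (pent_exp L i))%:R *
    pent_sgn R L i * X ^+ pent_exp L i * X ^+ 'C(j.+1, 2))`_m)) /=.
  by apply: eq_bigr => i _; rewrite mulr_sumr coef_sum.
rewrite -sum1_card natr_sum [in RHS]big_mkcond -!sumrMnl.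
apply: eq_bigr => -[i j] _; rewrite inE /= -mulrA -exprD sgnE.
rewrite -polyC_natr -polyCM coefCM coefXn eq_sym.
case: odd; rewrite /= ?mul0r // mul1r; case: eqP; rewrite ?mulr0 // mulr1 => _.
rewrite /pent_sgn -signr_odd; case: odd => //=.
by rewrite expr1; apply/val_inj.
Qed.

(** * Odd strongly unimodal sequences *)

(** The recursion decides on the entry 2 k' + 1, as [pochS] adds one factor. *)
Fixpoint odd_increasing k : seq (seq nat) :=
  if k is k'.+1 then
    odd_increasing k' ++ [seq rcons s k'.*2.+1 | s <- odd_increasing k']
  else [:: [::]].

Lemma mem_odd_increasing k s : s \in odd_increasing k =
  [&& pairwise ltn s, all odd s & all (ltn^~ k.*2) s].
Proof.
have all_lt i j t : all (ltn^~ i) t -> (i <= j)%N -> all (ltn^~ j) t.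
  by move=> h le; apply: sub_all h => y /= lt_y; apply: leq_trans le.
elim: k s => [|k IHk] s /=.
  case: s => [|x s] //=; rewrite inE /=.
  by rewrite !andbF.
rewrite mem_cat IHk; case/lastP: s => [|t x].
  by done.
rewrite !pairwise_rcons !all_rcons.
have -> : (rcons t x \in [seq rcons s k.*2.+1 | s <- odd_increasing k]) =
    (x == k.*2.+1) && (t \in odd_increasing k).
  apply/mapP/andP => [[s' hs'] /rcons_inj[-> ->]|[/eqP-> ht]].
    by rewrite eqxx hs'.
  by exists t.
rewrite IHk.
apply/idP/idP => [/orP[|]|].
- move=> /and3P[/andP[a b] /andP[c d] /andP[e f]]; rewrite a b c d /=.
  by rewrite (all_lt _ _ _ f) ?andbT; move: e => /=; lia.
- move=> /andP[/eqP-> /and3P[a b c]]; rewrite a b (all_lt _ _ _ c) ?(all_lt _ _ _ c) //=.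
    by rewrite odd_double; lia.
  by lia.
move=> /and3P[/andP[a b] /andP[c d] /andP[e f]].
have [lt_x|ge_x] := ltnP x k.*2.
  by rewrite a b c d (lt_x : ltn x k.*2) (all_lt _ _ _ a (ltnW lt_x)).
have ex : x = k.*2.+1 by lia.
apply/orP; right; rewrite ex eqxx b d /=.
apply/allP => y yt; have /allP/(_ y yt) := a; have /allP/(_ y yt) := d.
by rewrite ex /=; lia.
Qed.

Lemma odd_increasing_uniq k : uniq (odd_increasing k).
Proof.
elim: k => //= k IHk; rewrite cat_uniq IHk map_inj_uniq ?IHk ?andbT /=.
  apply/hasPn => _ /mapP[s _ ->]; rewrite mem_odd_increasing !all_rcons.
  by apply/negP => /and3P[_ _ /andP[]] /=; lia.
by move=> s t /rcons_inj[].
Qed.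

Definition peaked k : seq (seq nat) :=
  [seq a ++ k.*2.+1 :: rev b | a <- odd_increasing k, b <- odd_increasing k].

Definition peaked_below N := flatten [seq peaked k | k <- iota 0 N].

(** Recovers the peak from the sequence, so that the lists for different k are disjoint. *)
Lemma peaked_max k s : s \in peaked k -> \max_(x <- s) x = k.*2.+1.
Proof.
have H a : a \in odd_increasing k -> (\max_(x <- a) x <= k.*2)%N.
  rewrite mem_odd_increasing => /and3P[_ _ /allP h].
  by apply/bigmax_leqP_seq => x /h /= /ltnW.
move=> /allpairsP[[a b] /= [/H ha /H hb ->]].
have pr : perm_eq (rev b) b by rewrite perm_rev.
rewrite big_cat big_cons /= (perm_big _ pr) /=.
by rewrite (maxn_idPl (leqW hb)) (maxn_idPr (leqW ha)).
Qed.

Lemma peaked_uniq k : uniq (peaked k).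
Proof.
apply: allpairs_uniq; rewrite ?odd_increasing_uniq //.
have H a b : a \in odd_increasing k ->
    index k.*2.+1 (a ++ k.*2.+1 :: rev b) = size a.
  rewrite mem_odd_increasing => /and3P[_ _ /allP h].
  rewrite index_cat /= eqxx addn0 ifN //.
  by apply/negP => /h /=; lia.
move=> [a b] [a' b'] /allpairsP[[? ?] [/= ha _ [-> ->]]].
move=> /allpairsP[[? ?] [/= ha' _ [-> ->]]] E.
have := congr1 (index k.*2.+1) E; rewrite !H // => sz.
move/eqP: E; rewrite eqseq_cat // => /andP[/eqP-> /eqP[/(can_inj revK)->]].
by [].
Qed.

Lemma peaked_belowS N : peaked_below N.+1 = peaked_below N ++ peaked N.
Proof.
by rewrite /peaked_below -addn1 iotaD map_cat flatten_cat /= cats0.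
Qed.

Lemma peaked_below_uniq N : uniq (peaked_below N).
Proof.
elim: N => // N IHN; rewrite peaked_belowS cat_uniq IHN peaked_uniq andbT.
apply/hasPn => s /peaked_max ms; apply/negP => /flatten_mapP[k].
by rewrite mem_iota => hk /peaked_max; rewrite ms; lia.
Qed.

(** The peak 2 k + 1 is at most the weight, whence k < N. *)
Lemma mem_peaked_below N s : (sumn s <= N.*2)%N ->
  (s \in peaked_below N) = odd_strongly_unimodal s.
Proof.
have gt_trans : transitive gtn by move=> x y z /= h1 h2; apply: ltn_trans h1.
move=> hs; apply/flatten_mapP/idP => [[k _ /allpairsP[[a b] /= [ha hb ->]]]|].
  move: ha hb; rewrite !mem_odd_increasing => /and3P[pa oa la] /and3P[pb ob lb].
  rewrite /odd_strongly_unimodal all_cat oa /= all_rev ob odd_double /=.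
  have lt_i : (size a < size (a ++ k.*2.+1 :: rev b))%N.
    by rewrite size_cat /= -addSnnS leq_addr.
  apply/existsP; exists (Ordinal lt_i) => /=.
  rewrite drop_size_cat // take_cat ltnNge leqnSn /= subSnn /= take0 cats1.
  rewrite (path_sortedE gt_trans) rev_sorted.
  rewrite -[sorted _ b]/(sorted ltn b) !(sorted_pairwise ltn_trans).
  rewrite pairwise_rcons pa pb !andbT all_rev.
  apply/andP; split.
    by apply: sub_all la => x /=; lia.
  by apply: sub_all lb => x /=; lia.
move=> /andP[os /existsP[[i lt_i] /= /andP[]]].
rewrite (take_nth 0%N) // (drop_nth 0%N) //.
rewrite (sorted_pairwise ltn_trans) (sorted_pairwise gt_trans).
rewrite pairwise_rcons /= => /andP[la pa] /andP[lb pb].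
have oc : odd (nth 0%N s i) by apply: (allP os); rewrite mem_nth.
set c := nth 0%N s i in la lb oc.
have ck : c = c./2.*2.+1 by rewrite -[LHS]odd_double_half oc.
have H a : {subset a <= s} -> all (ltn^~ c) a -> all odd a && all (ltn^~ c./2.*2) a.
  move=> sub_as /allP h; apply/andP; split; apply/allP => x xa.
    by apply: (allP os); apply: sub_as.
  have /= := h x xa; have : odd x by apply: (allP os); apply: sub_as.
  by rewrite {1}ck; lia.
have sE : s = take i s ++ c :: rev (rev (drop i.+1 s)).
  by rewrite revK -drop_nth // cat_take_drop.
exists c./2.
  rewrite mem_iota /= add0n; have : (c <= sumn s)%N.
    by rewrite sE sumn_cat /=; lia.
  lia.
rewrite {1}sE {1}ck; apply: allpairs_f; rewrite mem_odd_increasing.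
  by rewrite pa /=; apply: H la => x /mem_take.
rewrite -(sorted_pairwise ltn_trans) rev_sorted (sorted_pairwise gt_trans) pb /=.
by apply: H; [move=> x; rewrite mem_rev => /mem_drop | rewrite all_rev].
Qed.

(** * Generating function of the sequences modulo 4 *)

Section Generating.
Context (R : comNzRingType).
Implicit Types L : seq (seq nat).

Lemma odd_increasing_gf k :
  \sum_(s <- odd_increasing k) 'X^(sumn s) = poch 'X ('X^2) k :> {poly R}.
Proof.
elim: k => [|k IHk]; first by rewrite big_seq1 poch0.
rewrite big_cat big_map pochS -IHk mulrDr mulr1 mulr_suml; congr (_ + _).
apply: eq_bigr => s _; by rewrite sumn_rcons exprD -mul2n exprS exprM.
Qed.

Lemma peaked_below_gf N : \sum_(s <- peaked_below N) 'X^(sumn s) =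
  \sum_(k < N) 'X^(k.*2.+1) * poch 'X ('X^2) k ^+ 2 :> {poly R}.
Proof.
elim: N => [|k IHk]; first by rewrite big_nil big_ord0.
rewrite peaked_belowS big_cat big_ord_recr IHk; congr (_ + _).
rewrite /peaked big_allpairs_dep expr2 -odd_increasing_gf mulr_suml mulr_sumr.
apply: eq_bigr => a _; rewrite !mulr_sumr; apply: eq_bigr => b _.
rewrite sumn_cat /= sumn_rev !exprD; ring.
Qed.

Lemma coef_sum_weight L n :
  (\sum_(s <- L) 'X^(sumn s) : {poly R})`_n =
  (size [seq s <- L | sumn s == n])%:R.
Proof.
rewrite coef_sum size_filter -sum1_count natr_sum [in RHS]big_mkcond /=.
by apply: eq_bigr => s _; rewrite coefXn eq_sym; case: eqP.
Qed.
End Generating.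

(* The cross terms of the squared product have odd degree in X. *)
Lemma poch_sqr_mod4 k : exists S : {poly 'Z_4},
  poch 'X ('X^2) k ^+ 2 =
  (poch 'X ('X^2) k \Po 'X^2) + 2 * ('X * (S \Po 'X^2)).
Proof.
elim: k => [|k [S IHk]].
  by exists 0; rewrite poch0 rmorph1 expr1n comp_poly0 !mulr0 addr0.
have P4 : 4 = 0 :> {poly 'Z_4} by rewrite -polyC_natr char_Zp.
set B := poch _ _ k in IHk.
have BE : (poch 'X ('X^2) k.+1 : {poly 'Z_4}) = B * (1 + 'X^(k.*2.+1)).
  by rewrite pochS -/B -mul2n [in RHS]exprS exprM.
rewrite BE exprMn IHk comp_polyM.
have -> : (1 + 'X^(k.*2.+1) : {poly 'Z_4}) \Po 'X^2 = 1 + ('X^(k.*2.+1)) ^+ 2.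
  by rewrite rmorphD rmorph1 rmorphXn /= comp_polyX -!exprM mulnC.
exists (S * (1 + 'X^(k.*2.+1)) + 'X^k * B).
rewrite comp_polyD !comp_polyM.
have -> : (1 + 'X^(k.*2.+1) : {poly 'Z_4}) \Po 'X^2 = 1 + ('X^(k.*2.+1)) ^+ 2.
  by rewrite rmorphD rmorph1 rmorphXn /= comp_polyX -!exprM mulnC.
have -> : ('X^k : {poly 'Z_4}) \Po 'X^2 = 'X^(k.*2).
  by rewrite rmorphXn /= comp_polyX -exprM mul2n.
have XY : 'X^(k.*2.+1) = 'X * 'X^(k.*2) :> {poly 'Z_4} by exact: exprS.
rewrite XY; set Y := 'X^(k.*2); set B2 := B \Po _; set S2 := S \Po _.
(* The old cross term times the new one is the multiple of 4. *)
rewrite [RHS](_ : _ = (B2 + 2 * ('X * S2)) * (1 + 'X * Y) ^+ 2 -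
  4 * ('X ^+ 2 * Y * S2)); last by ring.
by rewrite P4 mul0r subr0; ring.
Qed.

(** The sequences with peak 2 k + 1 contribute X^(2k+1) B(X)^2, where B is [poch 'X ('X^2) k]. The
    cross terms of B^2 only reach even weights; X^(2k) B(X^2) at 4 m is X^k B(X) at 2 m. *)
Lemma ou_star_nu m N : (2 * m < N)%N ->
  (ou_star (4 * m).+1)%:R = ((nu_gf N)`_(2 * m))%:~R :> 'Z_4.
Proof.
move=> ltN; have [l [ul ml <-]] := ou_starP (4 * m).+1.
have -> : size l = size [seq s <- peaked_below N | sumn s == (4 * m).+1].
  apply/perm_size/uniq_perm => //; first exact/filter_uniq/peaked_below_uniq.
  move=> s; rewrite ml mem_filter eqz_nat andbC.
  by case: eqP => //= hs; rewrite mem_peaked_below // hs; lia.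
rewrite -coef_sum_weight peaked_below_gf -coef_map rmorph_pochser.
rewrite !coef_sum; apply: eq_bigr => k _.
have [S ->] := poch_sqr_mod4 k.
rewrite mulrDr coefD rmorphXn /= map_polyX.
have even_coef (p : {poly 'Z_4}) i : (p \Po 'X^2)`_i = if odd i then 0 else p`_i./2.
  by rewrite coef_comp_poly_Xn // dvdn2 divn2; case: odd.
have Xk n : 'X^(n.*2) = 'X^n \Po 'X^2 :> {poly 'Z_4}.
  by rewrite rmorphXn /= comp_polyX -exprM mul2n.
rewrite [X in _ + X](_ : _ = 0) ?addr0.
  rewrite exprS -mulrA coefXM /= Xk -comp_polyM even_coef.
  by have -> : (4 * m = (2 * m).*2)%N; [lia | rewrite odd_double doubleK].
have -> : 'X^(k.*2.+1) * (2 * ('X * (S \Po 'X^2))) =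
  (('X^(k.+1) * S) \Po 'X^2) *+ 2 :> {poly 'Z_4}.
  by rewrite comp_polyM -Xk doubleS !exprS; ring.
by rewrite coefMn even_coef /= oddM mul0rn.
Qed.

(** * Representations by x^2 + 3 y^2 *)

Lemma size_half (T : eqType) (l : seq T) (f : T -> T) (P : pred T) :
  uniq l -> {in l, forall z, f z \in l} -> {in l, cancel f f} ->
  {in l, forall z, P (f z) = ~~ P z} -> size l = (2 * count P l)%N.
Proof.
move=> ul fl fK Pf; rewrite -(count_predC P l) mul2n -addnn; congr (_ + _)%N.
rewrite -!size_filter -(size_map f); apply/perm_size/uniq_perm.
- rewrite map_inj_in_uniq ?filter_uniq // => x y.
  by rewrite !mem_filter => /andP[_ xl] /andP[_ yl] E; rewrite -(fK x) // E fK.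
- exact: filter_uniq.
move=> z; rewrite mem_filter; apply/mapP/andP => [[x]|[Pz zl]].
  by rewrite mem_filter => /andP[/= nPx xl] ->; rewrite Pf // nPx fl.
by exists (f z); rewrite ?fK // mem_filter /= Pf // Pz fl.
Qed.

(** A bijection given by a relation, which avoids explicit maps into ordinals. *)
Lemma size_eq_rel (T1 T2 : eqType) (l1 : seq T1) (l2 : seq T2)
    (r : T1 -> T2 -> bool) : uniq l1 -> uniq l2 ->
  {in l1, forall a, exists2 b, b \in l2 & r a b} ->
  {in l2, forall b, exists2 a, a \in l1 & r a b} ->
  (forall a b b', r a b -> r a b' -> b = b') ->
  (forall a a' b, r a b -> r a' b -> a = a') -> size l1 = size l2.
Proof.
have le (S1 S2 : eqType) (s1 : seq S1) (s2 : seq S2) (q : S1 -> S2 -> bool) :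
    uniq s1 -> {in s1, forall a, exists2 b, b \in s2 & q a b} ->
    (forall a a' b, q a b -> q a' b -> a = a') -> (size s1 <= size s2)%N.
  case: s2 => [|d s2] us1 ex inj.
    by case: s1 us1 ex => // a s1 _ /(_ a (mem_head _ _))[].
  pose f a := nth d (d :: s2) (find (q a) (d :: s2)).
  have qf a : a \in s1 -> q a (f a).
    by move=> /ex[b bs qab]; apply: nth_find; apply/hasP; exists b.
  rewrite -(size_map f); apply: uniq_leq_size.
    rewrite map_inj_in_uniq // => a a' /qf qa /qf qa' E.
    by apply: inj qa _; rewrite E.
  move=> _ /mapP[a /ex[b bs qab] ->]; rewrite mem_nth // -has_find.
  by apply/hasP; exists b.
move=> u1 u2 ex1 ex2 inj2 inj1; apply/eqP; rewrite eqn_leq.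
rewrite (le _ _ _ _ _ u1 ex1 inj1) (le _ _ _ _ (fun b a => r a b)) //.
by move=> b b' a; apply: inj2.
Qed.

(** The box [-M, M] contains every solution, since |x| <= x^2 for integers. *)
Definition reps (M : nat) : seq (int * int) :=
  let box := [seq i%:Z - M%:Z | i <- iota 0 (2 * M).+1] in
  [seq z <- [seq (x, y) | x <- box, y <- box] | z.1 ^+ 2 + 3 * z.2 ^+ 2 == M%:Z].

Lemma mem_reps M z : (z \in reps M) = (z.1 ^+ 2 + 3 * z.2 ^+ 2 == M%:Z).
Proof.
rewrite mem_filter andb_idr // => /eqP E.
have H (x : int) : x ^+ 2 <= M%:Z -> x \in [seq i%:Z - M%:Z | i <- iota 0 (2 * M).+1].
  move=> le_x; have {}le_x : `|x| <= M%:Z.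
    by apply: le_trans le_x; rewrite expr2; nia.
  apply/mapP; exists (absz (x + M%:Z)); last by lia.
  by rewrite mem_iota; lia.
apply/allpairsP; exists z; rewrite -surjective_pairing.
split=> //; apply: H; rewrite -E.
  by rewrite lerDl mulr_ge0 ?sqr_ge0.
have := sqr_ge0 z.1; have := sqr_ge0 z.2.
by move: (z.1 ^+ 2) (z.2 ^+ 2) => a b; lia.
Qed.

Lemma reps_uniq M : uniq (reps M).
Proof.
by apply/filter_uniq/allpairs_uniq; rewrite ?map_inj_uniq ?iota_uniq //;
  [move=> i j; lia.. | move=> [a b] [c d] _ _ [-> ->]].
Qed.

(** The four sign changes act freely on points off the axes. *)
Lemma size_signs (l : seq (int * int)) : uniq l ->
  {in l, forall z, [/\ (- z.1, z.2) \in l, (z.1, - z.2) \in l, z.1 != 0 & z.2 != 0]} ->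
  exists q, size l = (4 * q)%N.
Proof.
move=> ul hl; exists (count (fun z => 0 < z.2) [seq z <- l | 0 < z.1]).
rewrite (@size_half _ l (fun z => (- z.1, z.2)) (fun z => 0 < z.1)) //.
- rewrite -size_filter.
  rewrite (@size_half _ [seq z <- l | 0 < z.1] (fun z => (z.1, - z.2))
    (fun z => 0 < z.2)) ?mulnA ?filter_uniq //.
  + by move=> z; rewrite !mem_filter => /andP[-> /hl[]].
  + by move=> [x y] _ /=; rewrite opprK.
  + by move=> [x y]; rewrite mem_filter => /andP[_ /hl[]] /=; lia.
- by move=> z /hl[].
- by move=> [x y] _ /=; rewrite opprK.
- by move=> [x y] /hl[] /=; lia.
Qed.

Definition is_square M := exists s, M = (s ^ 2)%N.

Lemma reps_neq0 M z : ~~ (3 %| M)%N -> ~ is_square M -> z \in reps M ->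
  z.1 != 0 /\ z.2 != 0.
Proof.
rewrite mem_reps; case: z => x y /= h3 nsq /eqP E; split; apply/eqP => z0.
  move: h3; rewrite -[M]/(`|M%:Z|%N) -E z0 expr0n add0r abszM.
  by rewrite dvdn_mulr.
apply: nsq; exists `|x|%N; apply/eqP; rewrite -eqz_nat -E z0.
by rewrite expr0n mulr0 addr0 -abszX; lia.
Qed.

Lemma reps_mul4 M : ~~ (3 %| M)%N -> ~ is_square M ->
  exists q, size (reps M) = (4 * q)%N.
Proof.
move=> h3 nsq; apply: size_signs; first exact: reps_uniq.
move=> z zM; have [? ?] := reps_neq0 h3 nsq zM; move: zM.
by rewrite !mem_reps /= !sqrrN.
Qed.

Lemma Euclid_dvdzM (p : nat) (x y : int) : prime p ->
  (p %| x * y)%Z = (p %| x)%Z || (p %| y)%Z.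
Proof. by move=> pp; rewrite !dvdzE abszM Euclid_dvdM. Qed.

Lemma Euclid_dvdzX (p : nat) (x : int) n : prime p ->
  (p %| x ^+ n)%Z = (p %| x)%Z && (0 < n)%N.
Proof. by move=> pp; rewrite !dvdzE abszX Euclid_dvdX. Qed.

(* The predicate says that a + b sqrt(-3) divides z.1 + z.2 sqrt(-3). *)
Lemma count_reps_multiple p M (a b : int) : prime p ->
  p%:Z = a ^+ 2 + 3 * b ^+ 2 ->
  count (fun z => (p %| a * z.2 - b * z.1)%Z) (reps (p * M)) = size (reps M).
Proof.
move=> pp pE; have p0 : p%:Z != 0 by have := prime_gt0 pp; lia.
(* Multiplication by a + b sqrt(-3), of norm p. *)
pose f (w : int * int) := (a * w.1 - 3 * b * w.2, a * w.2 + b * w.1).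
have fE w : (f w).1 ^+ 2 + 3 * (f w).2 ^+ 2 = p%:Z * (w.1 ^+ 2 + 3 * w.2 ^+ 2).
  by rewrite pE /f /=; ring.
rewrite -size_filter -[RHS](size_map f); apply/perm_size/uniq_perm.
- exact/filter_uniq/reps_uniq.
- rewrite map_inj_in_uniq ?reps_uniq // => -[x y] [x' y'] _ _ [E1 E2].
  have Ex : p%:Z * x = p%:Z * x'.
    transitivity (a * (a * x - 3 * b * y) + 3 * b * (a * y + b * x)).
      by rewrite pE; ring.
    by rewrite E1 E2 pE; ring.
  have Ey : p%:Z * y = p%:Z * y'.
    transitivity (a * (a * y + b * x) - b * (a * x - 3 * b * y)).
      by rewrite pE; ring.
    by rewrite E1 E2 pE; ring.
  by rewrite (mulfI p0 Ex) (mulfI p0 Ey).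
move=> z; rewrite mem_filter mem_reps; apply/andP/mapP => [[dz /eqP Ez]|[w]].
  (* Real part of z times the conjugate of a + b sqrt(-3). The imaginary part is divisible by p and
     so is the norm, hence also the real part; dividing by p then gives the preimage. *)
  have dx : (p %| a * z.1 + 3 * b * z.2)%Z.
    have : (p %| (a * z.1 + 3 * b * z.2) ^+ 2)%Z.
      have -> : (a * z.1 + 3 * b * z.2) ^+ 2 = p%:Z * (z.1 ^+ 2 + 3 * z.2 ^+ 2) -
        3 * (a * z.2 - b * z.1) * (a * z.2 - b * z.1) by rewrite pE; ring.
      by apply: rpredB; [exact: dvdz_mulr (dvdzz _) | exact: dvdz_mull].
    by rewrite Euclid_dvdzX // andbT.
  exists (((a * z.1 + 3 * b * z.2) %/ p)%Z, ((a * z.2 - b * z.1) %/ p)%Z); last first.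
    rewrite [z]surjective_pairing /f /=; congr (_, _); apply: (mulfI p0).
      transitivity (a * ((a * z.1 + 3 * b * z.2) %/ p)%Z * p%:Z -
        3 * b * (((a * z.2 - b * z.1) %/ p)%Z * p%:Z)); last by ring.
      by rewrite -mulrA !divzK // pE; ring.
    transitivity (a * (((a * z.2 - b * z.1) %/ p)%Z * p%:Z) +
      b * (((a * z.1 + 3 * b * z.2) %/ p)%Z * p%:Z)); last by ring.
    by rewrite !divzK // pE; ring.
  rewrite mem_reps /=; apply/eqP/(mulfI p0)/(mulfI p0).
  transitivity ((((a * z.1 + 3 * b * z.2) %/ p)%Z * p%:Z) ^+ 2 +
    3 * (((a * z.2 - b * z.1) %/ p)%Z * p%:Z) ^+ 2); first by ring.
  by rewrite PoszM in Ez; rewrite !divzK // -Ez pE; ring.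
rewrite mem_reps => /eqP Ew ->; split; last by rewrite fE Ew PoszM.
have -> : a * (f w).2 - b * (f w).1 = p%:Z * w.2 by rewrite pE /f /=; ring.
exact: dvdz_mulr.
Qed.

Lemma reps_multiple p M : prime p ->
  count (fun z => (p %| z.1)%Z && (p %| z.2)%Z) (reps (p ^ 2 * M)) = size (reps M).
Proof.
move=> pp; have p0 : p%:Z != 0 by have := prime_gt0 pp; lia.
rewrite -size_filter -[RHS](size_map (fun w : int * int => (p%:Z * w.1, p%:Z * w.2))).
apply/perm_size/uniq_perm; first exact/filter_uniq/reps_uniq.
  rewrite map_inj_uniq ?reps_uniq // => -[x y] [x' y'] /= [E1 E2].
  by rewrite (mulfI p0 E1) (mulfI p0 E2).
have E x y : (p%:Z * x) ^+ 2 + 3 * (p%:Z * y) ^+ 2 =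
    (p ^ 2)%:Z * (x ^+ 2 + 3 * y ^+ 2) by rewrite -mulnn PoszM; ring.
move=> [x y]; rewrite mem_filter mem_reps.
have p20 : (p ^ 2)%:Z != 0 by rewrite -mulnn PoszM mulf_neq0.
apply/andP/mapP => /= [[/andP[/dvdzP[u ->] /dvdzP[v ->]]]|[[u v]]].
  rewrite ![_ * p%:Z]mulrC E PoszM => /eqP/(mulfI p20)/eqP Euv.
  by exists (u, v); rewrite ?mem_reps.
rewrite mem_reps /= => /eqP Euv [-> ->]; rewrite !dvdz_mulr //.
by rewrite E Euv PoszM.
Qed.

(* Every solution for p M is divisible by a + b sqrt(-3) or by its conjugate,
   and by both exactly when it is p times a solution for M / p. *)
Lemma reps_hecke p M (a b : int) : prime p -> (3 < p)%N ->
  p%:Z = a ^+ 2 + 3 * b ^+ 2 ->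
  (size (reps (p * M)) + (if (p %| M)%N then size (reps (M %/ p)) else 0) =
   2 * size (reps M))%N.
Proof.
move=> pp p3 pE; have pE' : p%:Z = a ^+ 2 + 3 * (- b) ^+ 2 by rewrite sqrrN.
have p2 : ~~ (p %| 2)%Z by rewrite dvdzE; apply/negP => /dvdn_leq /=; lia.
have p3' : ~~ (p %| 3)%Z by rewrite dvdzE; apply/negP => /dvdn_leq /=; lia.
have pp1 : ~~ (p %| 1)%Z by rewrite dvdzE /= dvdn1; lia.
have pab : (p %| a)%Z = (p %| b)%Z.
  transitivity (p %| a ^+ 2)%Z; first by rewrite Euclid_dvdzX // andbT.
  have -> : a ^+ 2 = p%:Z - 3 * b ^+ 2 by rewrite pE; ring.
  rewrite rpredBl ?dvdzz // Euclid_dvdzM // Euclid_dvdzX // andbT.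
  by rewrite (negPf p3').
have pb : ~~ (p %| b)%Z.
  apply/negP => pb; move: pab; rewrite pb => /dvdzP[q aE].
  have [r bE] := dvdzP pb; apply/(negP pp1)/dvdzP; exists (q ^+ 2 + 3 * r ^+ 2).
  have p0 : p%:Z != 0 by lia.
  by apply: (mulfI p0); rewrite mulr1 {1}pE aE bE; ring.
have pa : ~~ (p %| a)%Z by rewrite pab.
have := count_predUI (fun z => (p %| a * z.2 - b * z.1)%Z)
  (fun z => (p %| a * z.2 - - b * z.1)%Z) (reps (p * M)).
rewrite !count_reps_multiple // mul2n -addnn => <-; congr (_ + _)%N.
  apply/esym/eqP; rewrite -all_count; apply/allP => z.
  rewrite mem_reps PoszM => /eqP Ez /=; rewrite -Euclid_dvdzM //.
  (* The product of the two imaginary parts is divisible by p, so at least one is. *)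
  have -> : (a * z.2 - b * z.1) * (a * z.2 - - b * z.1) =
    p%:Z * (z.2 ^+ 2) - b ^+ 2 * (z.1 ^+ 2 + 3 * z.2 ^+ 2) by rewrite pE; ring.
  rewrite Ez; apply: rpredB; first exact: dvdz_mulr (dvdzz _).
  exact: dvdz_mull (dvdz_mulr _ (dvdzz _)).
have -> : count (predI (fun z => (p %| a * z.2 - b * z.1)%Z)
  (fun z => (p %| a * z.2 - - b * z.1)%Z)) (reps (p * M)) =
  count (fun z => (p %| z.1)%Z && (p %| z.2)%Z) (reps (p * M)).
  apply: eq_count => -[x y] /=; apply/andP/andP => [[h1 h2]|[h1 h2]]; last first.
    by rewrite !rpredB ?dvdz_mull.
  have : (p %| 2 * (a * y))%Z.
    have -> : 2 * (a * y) = (a * y - b * x) + (a * y - - b * x) by ring.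
    by rewrite rpredD.
  have : (p %| 2 * (b * x))%Z.
    have -> : 2 * (b * x) = (a * y - - b * x) - (a * y - b * x) by ring.
    by rewrite rpredB.
  by rewrite !Euclid_dvdzM // (negPf p2) (negPf pa) (negPf pb).
case: ifP => [/dvdnP[q ->]|/negbT npM].
  have -> : (p * (q * p) = p ^ 2 * q)%N by rewrite -mulnn; lia.
  by rewrite mulnK ?prime_gt0 // reps_multiple.
apply/esym/eqP; rewrite -leqn0 leqNgt -has_count; apply/hasPn => z.
rewrite mem_reps PoszM => /eqP Ez; apply: contra npM => /andP[/dvdzP[u uE] /dvdzP[v vE]].
rewrite -[(p %| M)%N]/(p%:Z %| M%:Z)%Z; apply/dvdzP; exists (u ^+ 2 + 3 * v ^+ 2).
have p0 : p%:Z != 0 by lia.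
apply: (mulfI p0); rewrite -Ez uE vE; ring.
Qed.

(** * Split and inert primes *)

Lemma dvdz_Fp (p : nat) (x : int) : prime p ->
  (p %| x)%Z = (x%:~R == 0 :> 'F_p).
Proof. by move=> pp; rewrite -(dvdz_pcharf (pchar_Fp pp)). Qed.

Lemma natr_Fp_neq0 p n : prime p -> (0 < n < p)%N -> (n%:R : 'F_p) != 0.
Proof.
move=> pp /andP[n0 ltn]; rewrite -(dvdn_pcharf (pchar_Fp pp)).
by apply/negP => /dvdn_leq; lia.
Qed.

(* A nontrivial cube root of unity h gives (2 h + 1)^2 = -3. *)
Lemma sqrt_neg3 p : prime p -> (3 < p)%N -> (p %% 3 = 1)%N ->
  exists z : int, (p %| z ^+ 2 + 3)%Z.
Proof.
move=> pp p3 p1; pose k := (p %/ 3)%N; have pk : p = (3 * k).+1 by rewrite /k; lia.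
have k0 : (0 < k)%N by lia.
have [x x0 xk] : exists2 x : 'F_p, x != 0 & x ^+ k != 1.
  have [/exists_inP[x ? ?]|] := boolP [exists x in [pred y : 'F_p | y != 0], x ^+ k != 1].
    by exists x.
  (* Otherwise X^k - 1 would have all p - 1 = 3 k nonzero elements as roots. *)
  rewrite negb_exists_in => /forall_inP H.
  have := @max_poly_roots _ ('X^k - 1%:P : {poly 'F_p}) (enum [pred y | y != 0]).
  rewrite -size_poly_eq0 size_XnsubC // enum_uniq => /(_ isT).
  rewrite -cardE => /(_ _ isT); have -> : #|[pred y : 'F_p | y != 0]| = p.-1.
    by rewrite -[p in RHS]card_Fp // -(cardC1 (0 : 'F_p)); apply: eq_card.
  suff rt : all (root ('X^k - 1%:P)) (enum [pred y : 'F_p | y != 0]).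
    by move=> /(_ rt); lia.
  apply/allP => y; rewrite mem_enum => /H; rewrite negbK => /eqP yk.
  by rewrite /root !hornerE yk subrr.
pose h := x ^+ k; have h3 : h ^+ 3 = 1.
  apply: (mulIf x0); rewrite -exprM mulnC mul1r -exprSr -pk.
  by have := expf_card x; rewrite card_Fp.
have hh : h ^+ 2 + h + 1 = 0.
  have h1 : h - 1 != 0 by rewrite subr_eq0.
  apply: (mulfI h1); transitivity (h ^+ 3 - 1); first by ring.
  by rewrite h3 subrr mulr0.
have [w wE] : exists w : 'F_p, w = 2 * h + 1 by eexists.
exists (nat_of_ord w)%:Z; rewrite dvdz_Fp // rmorphD rmorphXn /= -pmulrn natr_Zp.
have -> : w ^+ 2 + 3%:~R = 4 * (h ^+ 2 + h + 1) by rewrite wE; ring.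
by rewrite hh mulr0.
Qed.

(** If p does not divide y, then x/y is a square root of -3 and yields h with h^2 + h + 1 = 0. From
    h^3 = 1, h^p = h and p = 2 modulo 3 follows h = 1, so 3 = 0. *)
Lemma inert_dvd p (x y : int) : prime p -> (3 < p)%N -> (p %% 3 = 2)%N ->
  (p %| x ^+ 2 + 3 * y ^+ 2)%Z -> (p %| x)%Z && (p %| y)%Z.
Proof.
move=> pp p3 p2 dvd; have [py|npy] := boolP (p %| y)%Z.
  rewrite andbT; suff : (p %| x ^+ 2)%Z by rewrite Euclid_dvdzX // andbT.
  by rewrite -(rpredDr _ (_ : 3 * y ^+ 2 \in dvdz p)) // expr2 !dvdz_mull.
move: dvd npy; rewrite !dvdz_Fp // rmorphD rmorphM !rmorphXn /=.
set X := x%:~R; set Y := y%:~R => /eqP E Y0.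
have two0 : (2 : 'F_p) != 0 by apply: natr_Fp_neq0; lia.
pose h := (X / Y - 1) / 2.
have hh : h ^+ 2 + h + 1 = 0.
  apply: (mulfI (mulf_neq0 (mulf_neq0 two0 two0) (mulf_neq0 Y0 Y0))).
  by rewrite mulr0 -E /h; field; rewrite Y0 two0.
have h3 : h ^+ 3 = 1.
  apply/eqP; rewrite -subr_eq0; apply/eqP.
  by transitivity ((h - 1) * (h ^+ 2 + h + 1)); [ring | rewrite hh mulr0].
have h0 : h != 0 by apply: contra_eqN h3 => /eqP->; rewrite expr0n eq_sym oner_eq0.
have hp : h ^+ p = h by have := expf_card h; rewrite card_Fp.
have pE : p = (3 * (p %/ 3) + 2)%N by lia.
have h1 : h = 1.
  apply: (mulfI h0); rewrite mulr1 -expr2 -[RHS]hp; clear -h3 pE.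
  by move: (h) h3 => c c3; transitivity (c ^+ (3 * (p %/ 3) + 2));
    [rewrite exprD exprM c3 expr1n mul1r | rewrite -pE].
have three0 : 3%:R = 0 :> 'F_p by transitivity (h ^+ 2 + h + 1); [rewrite h1; ring|].
by have := @natr_Fp_neq0 p 3 pp; rewrite three0 eqxx p3 => /(_ isT).
Qed.

Lemma int_parity (x : int) : exists a r, x = 2 * a + r /\ (r = 0 \/ r = 1).
Proof. by exists (x %/ 2)%Z, (x %% 2)%Z; lia. Qed.

Lemma sqrt_floor n : exists s, (s ^ 2 <= n < s.+1 ^ 2)%N.
Proof.
elim: n => [|n [s /andP[h1 h2]]]; first by exists 0%N.
have [h|h] := ltnP n.+1 (s.+1 ^ 2); first by exists s; rewrite h leqW.
by exists s.+1; move: h1 h2 h; rewrite -!mulnn; nia.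
Qed.

(** Thue's argument: with z^2 = -3 modulo p, the pigeonhole principle applied to i - z j gives x^2 +
    3 y^2 = k p with 0 < k < 4. *)
Lemma split_rep p : prime p -> (3 < p)%N -> (p %% 3 = 1)%N ->
  exists a b : int, p%:Z = a ^+ 2 + 3 * b ^+ 2.
Proof.
move=> pp p3 p1; have [z dz] := sqrt_neg3 pp p3 p1.
have [s /andP[les lts]] := sqrt_floor p.
have {}les : (s ^ 2 < p)%N.
  rewrite ltn_neqAle les andbT; apply/eqP => sp.
  by move: pp; rewrite -sp -mulnn => /primeP[_ /(_ s (dvdn_mulr _ (dvdnn _)))]; nia.
pose g (ij : 'I_s.+1 * 'I_s.+1) : 'F_p := ij.1%:R - z%:~R * ij.2%:R.
have : ~~ injectiveb g.
  apply/negP => /injectiveP /leq_card.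
  by rewrite card_prod card_ord card_Fp // mulnn leqNgt lts.
move=> /injectivePn[[i j] [[i' j'] neq]]; rewrite /g /= => E.
pose x := i%:Z - i'%:Z; pose y := j%:Z - j'%:Z.
have dxy : (p %| x - z * y)%Z.
  rewrite dvdz_Fp // /x /y !(rmorphB, rmorphM) /= -!pmulrn.
  rewrite -[X in _ == X](subrr (i%:R - z%:~R * j%:R)) {2}E; apply/eqP; ring.
have : (p %| x ^+ 2 + 3 * y ^+ 2)%Z.
  have -> : x ^+ 2 + 3 * y ^+ 2 = (x - z * y) * (x + z * y) + (z ^+ 2 + 3) * y ^+ 2.
    by ring.
  by rewrite rpredD ?dvdz_mulr.
move=> /dvdzP[k kE].
have p0 : 0 < p%:Z by lia.
have podd : odd p by case: (even_prime pp) => // p2; lia.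
have xy0 : 0 < x ^+ 2 + 3 * y ^+ 2.
  have hx := sqr_ge0 x; have hy : 0 <= 3 * y ^+ 2 by apply: mulr_ge0 => //; apply: sqr_ge0.
  rewrite lt0r paddr_eq0 // (addr_ge0 hx hy) andbT.
  rewrite [3 * _ == 0]mulf_eq0 !expf_eq0 /=; apply: contra neq => /andP[x0 y0].
  by apply/eqP; congr (_, _); apply/val_inj; move: x0 y0; rewrite /x /y /=; lia.
have bound (c d : 'I_s.+1) : (c%:Z - d%:Z) ^+ 2 <= (s ^ 2)%:Z.
  have hc := ltn_ord c; have hd := ltn_ord d; rewrite -subr_ge0 -mulnn PoszM.
  have -> : s%:Z * s%:Z - (c%:Z - d%:Z) ^+ 2 =
    (s%:Z - (c%:Z - d%:Z)) * (s%:Z + (c%:Z - d%:Z)) by ring.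
  by apply: mulr_ge0; lia.
have [xs ys] : x ^+ 2 <= (s ^ 2)%:Z /\ y ^+ 2 <= (s ^ 2)%:Z by split; exact: bound.
have k0 : 0 < k by move: xy0; rewrite kE pmulr_lgt0.
have k4 : k < 4.
  rewrite -(ltr_pM2r p0) -kE; move: xs ys les.
  by move: (x ^+ 2) (y ^+ 2) (s ^ 2)%N => u v w; lia.
have k3 : k = 1 \/ k = 2 \/ k = 3 by lia.
case: k3 => [k1|[k2|k3]].
- by exists x, y; rewrite kE k1 mul1r.
(* For k = 2 the value 2 p is 2 modulo 4, which the form never takes. *)
- have [a [r [xE rb]]] := int_parity x; have [b [t [yE tb]]] := int_parity y.
  have E4 : 4 * (a ^+ 2 + a * r + 3 * b ^+ 2 + 3 * b * t) + r ^+ 2 + 3 * t ^+ 2 =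
      2 * p%:Z by rewrite -k2 -kE xE yE; ring.
  move: E4; move: (_ + 3 * b * t) => c.
  clear -rb tb podd; by case: rb => ->; case: tb => ->; rewrite ?expr0n ?expr1n /=; lia.
have /dvdzP[q xE] : (3 %| x)%Z.
  suff : (3 %| x ^+ 2)%Z by rewrite (@Euclid_dvdzX 3) // andbT.
  rewrite -(rpredDr _ (_ : 3 * y ^+ 2 \in dvdz 3)) ?dvdz_mulr //.
  by rewrite kE k3 dvdz_mulr.
exists y, q; apply: (@mulfI _ (3 : int)) => //.
by transitivity (x ^+ 2 + 3 * y ^+ 2); [rewrite kE k3 | rewrite xE; ring].
Qed.

(** By [reps_hecke] the sizes form an arithmetic progression in e, with first term and difference
    [size (reps M)]. *)
Lemma reps_split p e M : prime p -> (3 < p)%N -> (p %% 3 = 1)%N ->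
  ~~ (p %| M)%N -> size (reps (p ^ e * M)) = (e.+1 * size (reps M))%N.
Proof.
move=> pp p3 p1 npM; have [a [b pE]] := split_rep pp p3 p1.
have p0 := prime_gt0 pp.
suff : size (reps (p ^ e * M)) = (e.+1 * size (reps M))%N /\
  size (reps (p ^ e.+1 * M)) = (e.+2 * size (reps M))%N by case.
elim: e => [|e [IH1 IH2]].
  rewrite expn0 expn1 !mul1n; have := reps_hecke M pp p3 pE.
  by rewrite (negPf npM) addn0.
split=> //; have := reps_hecke (p * (p ^ e * M)) pp p3 pE.
have pM i : (p * (p ^ i * M) = p ^ i.+1 * M)%N by rewrite mulnA -expnS.
rewrite dvdn_mulr // mulKn // IH1 !pM IH2; lia.
Qed.

(** All solutions are multiples of p, so e descends by 2 down to 1, where a solution would make p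
    divide M. *)
Lemma reps_inert p e M : prime p -> (3 < p)%N -> (p %% 3 = 2)%N ->
  ~~ (p %| M)%N -> odd e -> size (reps (p ^ e * M)) = 0%N.
Proof.
move=> pp p3 p2 npM oe; have p0 := prime_gt0 pp.
have inert N : (p %| N)%N ->
    all (fun z => (p %| z.1)%Z && (p %| z.2)%Z) (reps N).
  move=> pN; apply/allP => z; rewrite mem_reps => /eqP Ez.
  by apply: inert_dvd; rewrite // Ez.
rewrite -[e]odd_double_half oe; elim: (e./2) => [|i IHi].
  rewrite expn1; have /inert : (p %| p * M)%N by exact: dvdn_mulr.
  case: (reps _) (@mem_reps (p * M)) => // z l /(_ z).
  rewrite mem_head => /esym/eqP Ez /= /andP[/andP[/dvdzP[u uE] /dvdzP[v vE]] _].
  case/negP: npM; rewrite -[(p %| M)%N]/(p%:Z %| M%:Z)%Z.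
  apply/dvdzP; exists (u ^+ 2 + 3 * v ^+ 2); apply: (@mulfI _ p%:Z); first by lia.
  by rewrite -PoszM -Ez uE vE; ring.
have -> : (p ^ (true + i.+1.*2) * M = p ^ 2 * (p ^ (true + i.*2) * M))%N.
  by rewrite doubleS !addnS 2!expnS -mulnn !mulnA.
rewrite -[RHS]IHi -[RHS](reps_multiple _ pp).
apply/esym/eqP; rewrite -all_count; apply: inert.
by rewrite -mulnn -!mulnA dvdn_mulr.
Qed.

(** In the split case e + 1 is even and [reps_mul4] supplies the factor 4; in the inert case there
    is no solution. *)
Lemma reps_mul8 p e M : prime p -> (3 < p)%N -> odd e ->
  ~~ (p %| M)%N -> ~~ (3 %| M)%N -> ~ is_square M ->
  exists q, size (reps (p ^ e * M)) = (8 * q)%N.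
Proof.
move=> pp p3 oe npM n3M nsq.
have p03 : (p %% 3 != 0)%N.
  by rewrite -/(dvdn 3 p) dvdn_prime2 //; apply/eqP; lia.
have [p1|p2] : (p %% 3 = 1 \/ p %% 3 = 2)%N by lia.
  have [q E] := reps_mul4 n3M nsq; exists (e./2.+1 * q)%N.
  have eE : e.+1 = (2 * e./2.+1)%N by have := odd_double_half e; rewrite oe; lia.
  by rewrite reps_split // E eE !mulnA; congr (_ * _)%N; rewrite mulnAC.
by exists 0%N; rewrite reps_inert.
Qed.

(** * Pentagonal and triangular numbers *)

Definition pm3_mod8 (v : int) : bool := ((v %% 8)%Z == 3) || ((v %% 8)%Z == 5).

Lemma pm3_mod8N v : pm3_mod8 (- v) = pm3_mod8 v.
Proof. by rewrite /pm3_mod8; lia. Qed.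

Lemma mod_decomp (d : nat) (x : int) : (0 < d)%N ->
  exists q (r : nat), x = d%:Z * q + r%:Z /\ (r < d)%N.
Proof.
move=> d0; exists (x %/ d)%Z, `|(x %% d)%Z|%N.
have r0 : 0 <= (x %% d)%Z by apply: modz_ge0; lia.
have rd : (x %% d)%Z < d%:Z by apply: ltz_pmod; lia.
split; last by lia.
by rewrite gez0_abs // mulrC -divz_eq.
Qed.

(** Modulo 16, v^2 = 8 g + 1, which is 9 exactly when v is 3 or 5 modulo 8. *)
Lemma odd_pm3_mod8 (g : nat) (v : int) : 24 * g%:Z + 1 = v ^+ 2 ->
  odd g = pm3_mod8 v.
Proof.
have [q [r [-> r8]]] := @mod_decomp 8 v isT.
have -> : (8%:Z * q + r%:Z) ^+ 2 = 16 * (4 * q ^+ 2 + q * r%:Z) + r%:Z ^+ 2 by ring.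
move: (4 * q ^+ 2 + _) => c; rewrite /pm3_mod8.
by case: r r8 => [|[|[|[|[|[|[|[|r]]]]]]]] // _; rewrite expr2; lia.
Qed.

(** Just one of x and y is even. The squares of 3 y - x and 3 y + x differ by 12 x y, which is 8
    modulo 16 exactly when the even one is 2 modulo 4, that is when M is 5 or 7 modulo 8. *)
Lemma pm3_mod8_flip (M : nat) (x y : int) : x ^+ 2 + 3 * y ^+ 2 = M%:Z ->
  odd M -> pm3_mod8 (3 * - y - x) = pm3_mod8 (3 * y - x) (+) (4 < M %% 8)%N.
Proof.
have [a [r [-> r4]]] := @mod_decomp 4 x isT.
have [b [t [-> t4]]] := @mod_decomp 4 y isT.
have -> : (4%:Z * a + r%:Z) ^+ 2 + 3 * (4%:Z * b + t%:Z) ^+ 2 =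
  8 * (2 * a ^+ 2 + a * r%:Z + 6 * b ^+ 2 + 3 * b * t%:Z) +
  (r%:Z ^+ 2 + 3 * t%:Z ^+ 2) by ring.
move: (2 * a ^+ 2 + _ + _ + _) => c; rewrite /pm3_mod8.
by case: r r4 => [|[|[|[|r]]]] // _; case: t t4 => [|[|[|[|t]]]] // _;
  rewrite !expr2; lia.
Qed.

Lemma double_bin2 n : (2 * 'C(n.+1, 2) = n.+1 * n)%N.
Proof. by elim: n => // n IHn; rewrite binS bin1 mulnDr IHn; lia. Qed.

Lemma pent_expE L i :
  24 * (pent_exp L i)%:Z + 1 = (6 * (i%:Z - L%:Z) - 1) ^+ 2.
Proof.
rewrite /pent_exp; case: ltnP => [lt_iL|le_Li].
  have [s sE] : exists s, (L - i = s.+1)%N by exists (L - i).-1; lia.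
  rewrite sE; have -> : i%:Z - L%:Z = - s%:Z - 1 by lia.
  have := double_bin2 s; move: 'C(_, _) => c cE.
  transitivity (48 * s%:Z + 49 + 36 * (2 * c)%N%:Z); first by lia.
  by rewrite cE PoszM -[s.+1]addn1 PoszD; ring.
have [[|s] sE] : exists s, (i - L = s)%N by exists (i - L)%N.
  by rewrite sE; have -> : i%:Z - L%:Z = 0 by lia.
rewrite sE; have -> : i%:Z - L%:Z = s%:Z + 1 by lia.
have := double_bin2 s; move: 'C(_, _) => c cE.
transitivity (24 * s%:Z + 25 + 36 * (2 * c)%N%:Z); first by lia.
by rewrite cE PoszM -[s.+1]addn1 PoszD; ring.
Qed.

Lemma triangularE j : 8 * ('C(j.+1, 2))%:Z + 1 = (2 * j%:Z + 1) ^+ 2.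
Proof.
have := double_bin2 j; move: 'C(_, _) => c cE.
transitivity (4 * (2 * c)%N%:Z + 1); first by lia.
by rewrite cE PoszM -[j.+1]addn1 PoszD; ring.
Qed.

(** Ensures that k + L and j are valid ordinal indices. *)
Lemma small_sol (m L j : nat) (k : int) : (m < L)%N ->
  (6 * k - 1) ^+ 2 + 3 * (2 * j%:Z + 1) ^+ 2 = 24 * m%:Z + 4 ->
  - L%:Z <= k < L%:Z /\ (j < L)%N.
Proof.
have k2 : `|k| <= k * k by nia.
have j2 : j%:Z <= j%:Z * j%:Z by nia.
have -> : (6 * k - 1) ^+ 2 + 3 * (2 * j%:Z + 1) ^+ 2 =
  36 * (k * k) - 12 * k + 12 * (j%:Z * j%:Z) + 12 * j%:Z + 4 by ring.
by move: (k * k) (j%:Z * j%:Z) k2 j2 => K J; lia.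
Qed.

(** With v = 3 y - x and u = x + y one has v^2 + 3 u^2 = 4 M; the condition on v selects odd
    pentagonal numbers. *)
Definition odd_reps M := [seq z <- reps M | pm3_mod8 (3 * z.2 - z.1)].

Lemma mem_odd_reps M z : (z \in odd_reps M) =
  pm3_mod8 (3 * z.2 - z.1) && (z.1 ^+ 2 + 3 * z.2 ^+ 2 == M%:Z).
Proof. by rewrite mem_filter mem_reps. Qed.

(** Fixes the sign of v so that v = 6 k - 1. *)
Definition odd_reps_half M :=
  [seq z <- odd_reps M | ((3 * z.2 - z.1) %% 6)%Z == 5].

(* With v = 6 k - 1 and w = +-(2 j + 1) congruent to - v modulo 4, the point
   ((3 w - v) / 4, (v + w) / 4) lies on x^2 + 3 y^2 = 6 m + 1. *)
Lemma card_odd_pent m L : (m < L)%N ->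
  #|[set ij : 'I_(2 * L) * 'I_L | odd (pent_exp L ij.1) &&
      (pent_exp L ij.1 + 'C(ij.2.+1, 2) == m)%N]| =
  size (odd_reps_half (6 * m).+1).
Proof.
move=> ltmL; set S := [set ij | _]; rewrite cardE.
apply: (@size_eq_rel _ _ _ _ (fun (ij : 'I_(2 * L) * 'I_L) (z : int * int) =>
  (6 * (ij.1%:Z - L%:Z) - 1 == 3 * z.2 - z.1) &&
  (2 * ij.2%:Z + 1 == `|z.1 + z.2|))).
- exact: enum_uniq.
- by apply/filter_uniq/filter_uniq/reps_uniq.
- move=> [i j]; rewrite mem_enum inE /= => /andP[og /eqP gm].
  have gE := pent_expE L i; have tE := triangularE j.
  set v := 6 * (i%:Z - L%:Z) - 1 in gE *.
  (* The sign of w is chosen to make v + w divisible by 4. *)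
  have [y [w [yE wE]]] : exists y w, 4 * y = v + w /\ `|w| = 2 * j%:Z + 1.
    have [h|h] : (v %% 4)%Z = ((2 * j%:Z + 1) %% 4)%Z \/
      (v %% 4)%Z = (- (2 * j%:Z + 1) %% 4)%Z by rewrite /v; lia.
      by exists ((v - (2 * j%:Z + 1)) %/ 4)%Z, (- (2 * j%:Z + 1)); lia.
    by exists ((v + (2 * j%:Z + 1)) %/ 4)%Z, (2 * j%:Z + 1); lia.
  exists (w - y, y); last by rewrite /= subrK wE eqxx andbT; apply/eqP; lia.
  have vE : 3 * y - (w - y) = v by lia.
  rewrite 2!mem_filter mem_reps /= vE -(odd_pm3_mod8 gE) og.
  have -> : (v %% 6)%Z == 5 by rewrite /v; lia.
  apply/eqP/(@mulfI _ (4 : int)) => //.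
  transitivity ((4 * y - w) ^+ 2 + 3 * w ^+ 2); first by ring.
  have -> : 4 * y - w = v by lia.
  rewrite -[w ^+ 2]real_normK ?num_real // wE -gE -tE; lia.
- move=> [x y]; rewrite 2!mem_filter mem_reps /= => /and3P[v6 v8 /eqP E].
  have E4 : (3 * y - x) ^+ 2 + 3 * (`|x + y|) ^+ 2 = 24 * m%:Z + 4.
    rewrite real_normK ?num_real //.
    transitivity (4 * (x ^+ 2 + 3 * y ^+ 2)); first by ring.
    by rewrite E; lia.
  have [k kE] : exists k, 3 * y - x = 6 * k - 1.
    by exists ((3 * y - x + 1) %/ 6)%Z; clear -v6; lia.
  have [j jE] : exists j : nat, `|x + y| = 2 * j%:Z + 1.
    by exists (absz (x + y))./2; move: v8; clear; rewrite /pm3_mod8; lia.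
  rewrite kE jE in E4.
  have [kL jL] : - L%:Z <= k < L%:Z /\ (j < L)%N by apply: small_sol ltmL E4.
  have iL : (absz (k + L%:Z)%R < 2 * L)%N by clear -kL; lia.
  have kk : (absz (k + L%:Z)%R)%:Z - L%:Z = k by clear -kL; lia.
  exists (Ordinal iL, Ordinal jL); last by rewrite /= kk kE jE !eqxx.
  rewrite mem_enum inE /=.
  have gE := pent_expE L (absz (k + L%:Z)%R); have tE := triangularE j.
  rewrite kk in gE; rewrite (odd_pm3_mod8 gE) -kE v8 /=.
  by move: E4; rewrite -gE -tE; clear; lia.
- by move=> [i j] [x y] [x' y'] /= /andP[/eqP h1 /eqP h2] /andP[/eqP h3 /eqP h4];
    congr (_, _); lia.
by move=> [i j] [i' j'] [x y] /= /andP[/eqP h1 /eqP h2] /andP[/eqP h3 /eqP h4];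
  congr (_, _); apply/val_inj => /=; lia.
Qed.

(** The map z to -z exchanges the classes 1 and 5 modulo 6 of v, which is odd and prime to 3. *)
Lemma odd_reps_double M : ~~ (3 %| M)%N ->
  size (odd_reps M) = (2 * size (odd_reps_half M))%N.
Proof.
move=> n3; rewrite [size (odd_reps_half M)]size_filter.
apply: (@size_half _ _ (fun z => (- z.1, - z.2))).
- exact/filter_uniq/reps_uniq.
- move=> [x y]; rewrite !mem_odd_reps /= !sqrrN => /andP[h ->].
  by rewrite andbT -pm3_mod8N mulrN opprB opprK addrC.
- by move=> [x y] _ /=; rewrite !opprK.
move=> [x y]; rewrite mem_odd_reps /= => /andP[v8 /eqP E].
have nx : ~~ (3 %| x)%Z.
  apply: contra n3 => /dvdzP[q xE]; rewrite -[(3 %| M)%N]/(3%:Z %| M%:Z)%Z -E xE.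
  by apply/dvdzP; exists (3 * q ^+ 2 + y ^+ 2); ring.
by move: nx v8; clear; rewrite /pm3_mod8; lia.
Qed.

(** If M is 5 or 7 modulo 8, the reflection of y shows that [odd_reps] is half of [reps]. Otherwise
    [odd_reps] is stable under all sign changes. Either way its size is a multiple of 4. *)
Lemma odd_reps_half_even (M : nat) : odd M -> ~~ (3 %| M)%N -> ~ is_square M ->
  ((4 < M %% 8)%N -> exists q, size (reps M) = (8 * q)%N) ->
  ~~ odd (size (odd_reps_half M)).
Proof.
move=> oM n3 nsq h8; have dbl := odd_reps_double n3.
have flip z : z \in reps M -> pm3_mod8 (3 * - z.2 - z.1) =
    pm3_mod8 (3 * z.2 - z.1) (+) (4 < M %% 8)%N.
  by rewrite mem_reps => /eqP E; apply: pm3_mod8_flip.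
have [big|small] := boolP (4 < M %% 8)%N.
  have [q sz] := h8 big.
  have := @size_half _ (reps M) (fun z => (z.1, - z.2))
    (fun z => pm3_mod8 (3 * z.2 - z.1)) (reps_uniq M).
  rewrite -size_filter -/(odd_reps M) sz dbl => H.
  suff : (8 * q = 2 * (2 * size (odd_reps_half M)))%N by clear; lia.
  apply: H => [z|[x y] _ /=|z /flip]; rewrite ?opprK //.
    by rewrite !mem_reps /= sqrrN.
  by rewrite big addbT.
have [q sz] : exists q, size (odd_reps M) = (4 * q)%N.
  apply: size_signs; first exact/filter_uniq/reps_uniq.
  move=> z zO; have := zO; rewrite mem_filter => /andP[_ zM].
  have [z1 z2] := reps_neq0 n3 nsq zM; have := flip z zM.
  rewrite (negPf small) addbF => fz; move: zO.
  rewrite !mem_odd_reps /= !sqrrN => /andP[vz ->]; rewrite !andbT; split=> //.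
    have -> : 3 * z.2 - - z.1 = - (3 * - z.2 - z.1) by ring.
    by rewrite pm3_mod8N fz.
  by rewrite fz.
by move: sz; rewrite dbl; clear; lia.
Qed.

(** * The congruence *)

Lemma ou_star_mod4 m : ~ is_square (6 * m).+1 ->
  ((4 < (6 * m).+1 %% 8)%N -> exists q, size (reps (6 * m).+1) = (8 * q)%N) ->
  (ou_star (4 * m).+1 %% 4 = 0)%N.
Proof.
move=> nsq h8; have : (ou_star (4 * m).+1)%:R = 0 :> 'Z_4.
  rewrite (@ou_star_nu m (2 * m).+1) // nu_even_coef //.
  apply: (@nu_even_mod4 _ _ (2 * m).+2); first by lia.
    (* If m is 4 times a pentagonal number g, then 6 m + 1 = 24 g + 1 is a square. *)
    move=> i; apply/eqP => im; apply: nsq.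
    exists (absz (6 * (i%:Z - (2 * m).+2%:Z) - 1)%R).
    apply/eqP; rewrite -eqz_nat -abszX abszE ger0_norm ?sqr_ge0 //.
    by rewrite -pent_expE; lia.
  rewrite card_odd_pent; last by lia.
  by apply: odd_reps_half_even => //; lia.
by move/(congr1 val); rewrite /= val_Zp_nat.
Qed.

(** * Arithmetic of the weights in the progressions *)

Lemma ou_star_lt0 m : m < 0 -> ou_star m = 0%N.
Proof.
move=> m0; apply/eqP; rewrite cards_eq0; apply/eqP/setP => s; rewrite !inE.
by apply/negbTE/negP => /andP[_ /eqP sm]; move: m0; rewrite -sm.
Qed.

Lemma sqr_mod24 x : odd x -> ~~ (3 %| x)%N -> (x ^ 2 %% 24 = 1)%N.
Proof.
move=> ox x3; rewrite -modnXm; have := ltn_pmod x (isT : (0 < 24)%N).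
have : odd (x %% 24) by lia.
have : ~~ (3 %| x %% 24)%N by lia.
move: (x %% 24)%N => r.
by do 24!case: r => [|r] //.
Qed.

Lemma prime_square_part (p A : nat) : prime p -> (0 < A)%N ->
  exists a c, A = (p ^ a * c)%N /\ ~~ (p %| c)%N.
Proof.
move=> pp A0; have [c npc E] := pfactor_coprime pp A0.
exists (logn p A), c; rewrite mulnC -E; split=> //.
by rewrite -prime_coprime.
Qed.

Lemma not_square_odd_pfactor (p a M : nat) : prime p -> ~~ (p %| M)%N ->
  ~ is_square (p ^ (2 * a).+1 * M).
Proof.
move=> pp npM [s E]; have M0 : (0 < M)%N by case: M npM {E}; rewrite ?dvdn0.
have lM : logn p M = 0%N by apply/eqP; rewrite lognE pp M0 (negPf npM).
have pa0 : (0 < p ^ (2 * a).+1)%N by rewrite expn_gt0 prime_gt0.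
have : logn p (p ^ (2 * a).+1 * M) = (2 * a).+1.
  by rewrite (lognM p pa0 M0) pfactorK // lM addn0.
by rewrite E lognX; lia.
Qed.

(** Modulo p, [a] is the square of s/c. *)
Lemma legendre_square (p : nat) (a : int) (c s t : nat) : prime p ->
  ~~ (p %| c)%N -> (c ^ 2 * t = s ^ 2)%N -> (p %| t%:Z - a)%Z ->
  legendre a p != -1.
Proof.
move=> pp npc E ta; rewrite /legendre; case: ifP => // _.
rewrite ifT //; apply/existsP.
have c0 : c%:R != 0 :> 'F_p by rewrite -(dvdn_pcharf (pchar_Fp pp)).
have [w wE] : exists w : 'F_p, w = s%:R / c%:R by eexists.
have wp : (w < p)%N by rewrite -[X in (_ < X)%N](Fp_cast pp) ltn_ord.
exists (Ordinal wp) => /=; rewrite eqz_mod_dvd -[_ - a](subrKA t%:Z).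
rewrite rpredD // dvdz_Fp // rmorphB rmorphXn /= -!pmulrn natr_Zp subr_eq0.
by rewrite wE expr_div_n -natrX -E natrM natrX mulrAC divff ?mul1r // expf_neq0.
Qed.

(** Covers odd j with e = 4 and even j with e = 1. Here M = A^2 q u with u = 3 j modulo q. As q may
    divide A, its exponent in M is 2 a + 1, where q^a is the exact power of q in A. *)
Lemma ou_star_progression (A q n e : nat) (j N : int) :
  odd A -> ~~ (3 %| A)%N -> prime q -> (5 <= q)%N -> ~~ (q %| j)%Z ->
  ((q != 7 %[mod 24])%N /\ (q != 13 %[mod 24])%N) \/
    legendre (3 * j) q = -1 ->
  3 * N - 1 = 2 * A%:Z ^+ 2 * q%:Z * (6 * q%:Z * n%:Z + 3 * j + e%:Z * q%:Z) ->
  (N %% 4)%Z = 1 -> (ou_star N %% 4 = 0)%N.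
Proof.
(* A negative j can make the weight negative. *)
move=> oA A3 pq q5 qj hq NE N4; have [N0|N0] := ltP N 0; first by rewrite ou_star_lt0.
set u := 6 * q%:Z * n%:Z + 3 * j + e%:Z * q%:Z in NE.
have [m Nm] : exists m, N = (4 * m).+1%:Z by exists (absz (N %/ 4)%Z); lia.
have A0 : (0 < A)%N by case: (A) oA.
have q0 : (0 < q)%N by lia.
have ME : (6 * m).+1%:Z = A%:Z ^+ 2 * q%:Z * u.
  apply: (@mulfI _ (2 : int)) => //.
  by transitivity (3 * N - 1); [rewrite Nm; clear; lia | rewrite NE; ring].
have u0 : 0 < u.
  have : 0 < A%:Z ^+ 2 * q%:Z by rewrite mulr_gt0 ?exprn_gt0.
  by move=> /pmulr_rgt0 <-; rewrite -ME.
have [t tE] : exists t : nat, u = t%:Z by exists (absz u); lia.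
have q3 : ~~ (q %| 3)%N by apply/negP => /dvdn_leq; lia.
have qu : (q %| t%:Z - 3 * j)%Z.
  rewrite -tE; apply/dvdzP; exists (6 * n%:Z + e%:Z); rewrite /u; ring.
have qt : ~~ (q %| t)%N.
  apply/negP => qt; have : (q %| t%:Z - (t%:Z - 3 * j))%Z by apply: rpredB.
  by rewrite opprB addrC subrK Euclid_dvdzM // (negPf qj) orbF; apply/negP.
have [a [c [AE qc]]] := prime_square_part pq A0.
have {}ME : (6 * m).+1 = (q ^ (2 * a).+1 * (c ^ 2 * t))%N.
  have -> : (6 * m).+1 = (A ^ 2 * q * t)%N.
    by apply/eqP; rewrite -eqz_nat ME tE -mulnn !PoszM expr2.
  by rewrite AE expnMn -expnM [(2 * a)%N]mulnC [(q ^ (a * 2).+1)%N]expnS; ring.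
have qct : ~~ (q %| c ^ 2 * t)%N by rewrite Euclid_dvdM // Euclid_dvdX // andbT negb_or qc.
rewrite Nm; apply: ou_star_mod4; rewrite ME; first exact: not_square_odd_pfactor.
rewrite -ME => big; have m3 : ~~ (3 %| (6 * m).+1)%N by clear; lia.
rewrite ME; apply: reps_mul8 => //.
- exact: leq_trans q5.
- by rewrite /= oddM.
- by apply: contra m3 => h; rewrite ME dvdn_mull.
(* If c^2 t were a square, M would be q times a square prime to 6, so q = M modulo 24, which is 7 or
   13 here; and 3 j would be a square modulo q. *)
move=> [s cts]; have q24 : (q %% 24 = (6 * m).+1 %% 24)%N.
  have Mx : (6 * m).+1 = (q * (q ^ a * s) ^ 2)%N.
    by rewrite ME cts expnMn -expnM mulnA -expnS [(a * 2)%N]mulnC.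
  have : odd (6 * m).+1 by rewrite /= oddM.
  rewrite {1}Mx oddM oddX /= => /andP[_ ox].
  have x3 : ~~ (3 %| q ^ a * s)%N.
    by apply: contra m3 => h; rewrite Mx dvdn_mull ?dvdn_exp.
  by rewrite Mx -modnMmr sqr_mod24 // muln1.
case: hq => [[]|hl]; first by rewrite q24; move: big; clear; lia.
by have := legendre_square pq qc cts qu; rewrite hl.
Qed.

(* Both divisions by 3 are exact: a prime p >= 5 has p ^ 2 = 1 modulo 3. *)
Theorem theorem6p2 (k : nat) (p : nat -> nat)
    (hp : forall r : nat, (1 <= r <= k.+1)%N -> prime (p r) /\ (5 <= p r)%N)
    (j : int) (hj : ~~ (p k.+1 %| j)%Z)
    (hcase : ((p k.+1 != 7 %[mod 24])%N /\ (p k.+1 != 13 %[mod 24])%N) \/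
             (((p k.+1 == 7 %[mod 24])%N \/ (p k.+1 == 13 %[mod 24])%N) /\
              legendre (3 * j) (p k.+1) = -1))
    (n : nat) :
  let Pk : int := \prod_(1 <= r < k.+1) (p r)%:Z ^+ 2 in
  let Pk1 : int := \prod_(1 <= r < k.+2) (p r)%:Z ^+ 2 in
  (~~ (2 %| j)%Z ->
     ou_star (4 * Pk1 * n%:Z + 2 * Pk * (p k.+1)%:Z * j
              + ((8 * Pk1 + 1) %/ 3)%Z) = 0 %[mod 4])%N /\
  ((2 %| j)%Z ->
     ou_star (4 * Pk1 * n%:Z + 2 * Pk * (p k.+1)%:Z * j
              + ((2 * Pk1 + 1) %/ 3)%Z) = 0 %[mod 4])%N.
Proof.
pose q := p k.+1; pose A := (\prod_(1 <= r < k.+1) p r)%N => Pk Pk1.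
have [pq q5] : prime q /\ (5 <= q)%N by apply: hp; rewrite leqnn.
have PkE : Pk = A%:Z ^+ 2.
  by rewrite /Pk /A -!natz natr_prod -prodrXl; apply: eq_bigr => r _; rewrite natz.
have Pk1E : Pk1 = A%:Z ^+ 2 * q%:Z ^+ 2 by rewrite /Pk1 big_nat_recr //= -/Pk PkE.
have coprime6 x : prime x -> (5 <= x)%N -> odd x /\ ~~ (3 %| x)%N.
  move=> px x5; split; first by case: (even_prime px) => // x2; lia.
  by rewrite dvdn_prime2 //; apply/eqP; lia.
have [oA A3] : odd A /\ ~~ (3 %| A)%N.
  rewrite /A big_nat; elim/big_ind: _ => // [x y [ox x3] [oy y3]|r /andP[r1 rk]].
    by rewrite oddM ox oy Euclid_dvdM // negb_or x3 y3.
  by have [] := hp r; [rewrite r1 leqW | exact: coprime6].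
have [oq q3] := coprime6 _ pq q5.
(* Squares of integers prime to 6 are 1 modulo 24; this makes both divisions by 3 explicit. *)
have [w wE] : exists w : nat, A%:Z ^+ 2 * q%:Z ^+ 2 = 24 * w%:Z + 1.
  exists ((A * q) ^ 2 %/ 24)%N; rewrite -exprMn -PoszM expr2 -PoszM mulnn.
  rewrite {1}(divn_eq ((A * q) ^ 2) 24) sqr_mod24 ?oddM ?oA //.
    by rewrite PoszD PoszM mulrC.
  by rewrite Euclid_dvdM // negb_or A3 q3.
have [h hE] : exists h : int, A%:Z ^+ 2 * q%:Z = 2 * h + 1.
  exists ((A * A * q)./2)%:Z; rewrite expr2 -!PoszM.
  have : odd (A * A * q) by rewrite !oddM oA oq.
  by move: (A * A * q)%N; clear; lia.
have hq : ((q != 7 %[mod 24])%N /\ (q != 13 %[mod 24])%N) \/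
  legendre (3 * j) q = -1 by case: hcase => [?|[_ ?]]; [left | right].
split=> j2.
  rewrite Pk1E wE PkE; apply: (@ou_star_progression A q n 4 j) => //.
    have -> : ((8 * (24 * w%:Z + 1) + 1) %/ 3)%Z = 64 * w%:Z + 3 by clear; lia.
    transitivity (12 * (24 * w%:Z + 1) * n%:Z + 6 * (A%:Z ^+ 2 * q%:Z) * j +
      8 * (24 * w%:Z + 1)); first by ring.
    by rewrite -wE; ring.
  (* The weight is 1 modulo 4: for odd j the term 2 A^2 q j is 2 and the quotient by 3 is 3; for
     even j they are 0 and 1. *)
  have [i jE] : exists i, j = 2 * i + 1 by exists (j %/ 2)%Z; move: j2; clear; lia.
  have -> : ((8 * (24 * w%:Z + 1) + 1) %/ 3)%Z = 64 * w%:Z + 3 by clear; lia.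
  have -> : 4 * (24 * w%:Z + 1) * n%:Z + 2 * A%:Z ^+ 2 * (p k.+1)%:Z * j +
      (64 * w%:Z + 3) = 4 * ((24 * w%:Z + 1) * n%:Z + 16 * w%:Z + 1 +
      (2 * h * i + h + i)) + 1 by rewrite -/q -[2 * _ * _]mulrA hE jE; ring.
  by clear; lia.
rewrite Pk1E wE PkE; apply: (@ou_star_progression A q n 1 j) => //.
  have -> : ((2 * (24 * w%:Z + 1) + 1) %/ 3)%Z = 16 * w%:Z + 1 by clear; lia.
  transitivity (12 * (24 * w%:Z + 1) * n%:Z + 6 * (A%:Z ^+ 2 * q%:Z) * j +
    2 * (24 * w%:Z + 1)); first by ring.
  by rewrite -wE; ring.
have [i jE] : exists i, j = 2 * i by exists (j %/ 2)%Z; move: j2; clear; lia.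
have -> : ((2 * (24 * w%:Z + 1) + 1) %/ 3)%Z = 16 * w%:Z + 1 by clear; lia.
have -> : 4 * (24 * w%:Z + 1) * n%:Z + 2 * A%:Z ^+ 2 * (p k.+1)%:Z * j +
    (16 * w%:Z + 1) = 4 * ((24 * w%:Z + 1) * n%:Z + 4 * w%:Z +
    (2 * h * i + i)) + 1 by rewrite -/q -[2 * _ * _]mulrA hE jE; ring.
by clear; lia.
Qed.
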